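(* Let $s\in[-1,1]$, $\varepsilon_{\mathrm{sgn}}\in\{-1,1\}$ and $k\ge1$. There exists $\mu$ satisfying $\langle\mu,\varphi_k\rangle=0$ and the following properties. (i) One has $\mu\in\mathcal H_\infty^{s+\frac12}(0,1)$ if $s\in[-1,0)$; $\mu$ is a linear combination of two eigenfunctions $\varphi_n$ if $s=0$; and $\mu\in\mathcal H^s_\infty(0,1)$ if $s\in(0,1]$. (ii) There exist $\alpha>0$ and $\nu>0$ such that $$K_{\mu,k}(\omega)=\varepsilon_{\mathrm{sgn}}\frac{\alpha}{\langle\omega\rangle^{2+s}}+\mathcal O\left(\frac1{\langle\omega\rangle^{2+s+\nu}}\right)\quad\text{when }\omega\to+\infty.$$ (iii) For all $\omega\in\mathbb R$, $\varepsilon_{\mathrm{sgn}}K_{\mu,k}(\omega)>0$.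
   Context: For $j\ge1$, $\lambda_j=(j\pi)^2$, $\varphi_j(x)=\sqrt2\sin(j\pi x)$; $\langle\cdot,\cdot\rangle$ is the $L^2(0,1)$ scalar product (extended by duality). $\langle\omega\rangle:=(1+\omega^2)^{1/2}$. For $s\in\mathbb R$, $p\in[1,\infty]$, $\mathcal H^s_p(0,1)$ is the space of (generalized) real sine series $\mu=\sum_j\langle\mu,\varphi_j\rangle\varphi_j$ with $\|\mu\|_{\mathcal H^s_p}:=\|(\lambda_j^{s/2}\langle\mu,\varphi_j\rangle)_{j\ge1}\|_{\ell^p}<\infty$. With $\lambda_{n,k}:=\lambda_n-\frac{\lambda_k}2$, for $\omega\in\mathbb R$, $$K_{\mu,k}(\omega)=\sum_{n\ge1}\frac{\langle\mu,\varphi_n\rangle}{n}\left(\frac{\langle\mu,\varphi_{n+k}\rangle}{n+k}+\frac{\langle\mu,\varphi_{|n-k|}\rangle}{|n-k|}\mathbb 1_{n\ne k}\right)\frac{\lambda_{n,k}}{\lambda_{n,k}^2+\omega^2}.$$ *)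

(* Defs.v *)
From Stdlib Require Import Reals.
From Coquelicot Require Import Coquelicot.

Open Scope R_scope.

(** A generalized real sine series [mu = sum_{j >= 1} <mu, phi_j> phi_j] is
    given by its coefficients: [mu : nat -> R] with [mu j = <mu, phi_j>] for
    [j >= 1].  The value [mu 0] has no meaning and is never used. *)

Definition lambda (j : nat) : R := (INR j * PI) ^ 2.

Definition phi (j : nat) (x : R) : R := sqrt 2 * sin (INR j * PI * x).

(** The [L^2(0,1)] scalar product, as a Riemann integral: it is only applied
    to continuous functions. *)
Definition scal_L2 (f g : R -> R) : R := RInt (fun x => f x * g x) 0 1.

(** [mu] is (the sine series of) the function [f]. *)
Definition is_sine_series_of (mu : nat -> R) (f : R -> R) : Prop :=
  forall j : nat, (1 <= j)%nat -> mu j = scal_L2 f (phi j).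

Definition two_mode_combination (mu : nat -> R) : Prop :=
  exists (n m : nat) (a b : R),
    (1 <= n)%nat /\ (1 <= m)%nat /\ n <> m /\
    is_sine_series_of mu (fun x => a * phi n x + b * phi m x).

(** The norm of [H^s_p(0,1)] for [p = infinity]; the shift [S i] makes the
    supremum range over [j >= 1]. *)
Definition Hinf_norm (s : R) (mu : nat -> R) : Rbar :=
  Sup_seq (fun i : nat =>
    Finite (Rabs (Rpower (lambda (S i)) (s / 2) * mu (S i)))).

Definition in_Hinf (s : R) (mu : nat -> R) : Prop :=
  Rbar_lt (Hinf_norm s mu) p_infty.

Definition lambda2 (n k : nat) : R := lambda n - lambda k / 2.

(** [|n - k|], the subtraction of [nat] being truncated. *)
Definition absdiff (n k : nat) : nat := ((n - k) + (k - n))%nat.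

Definition K_term (mu : nat -> R) (k : nat) (w : R) (n : nat) : R :=
  mu n / INR n *
  (mu (n + k)%nat / INR (n + k) +
   (if Nat.eqb n k then 0 else mu (absdiff n k) / INR (absdiff n k))) *
  (lambda2 n k / (lambda2 n k ^ 2 + w ^ 2)).

(** The sum ranges over [n >= 1].  It converges absolutely as soon as
    [in_Hinf r mu] for some [r >= -1/2]. *)
Definition K (mu : nat -> R) (k : nat) (w : R) : R :=
  Series (fun i : nat => K_term mu k w (S i)).

Definition japanese (w : R) : R := sqrt (1 + w ^ 2).

Definition bigO_pinfty (f g : R -> R) : Prop :=
  exists C : R, Rbar_locally p_infty (fun w => Rabs (f w) <= C * Rabs (g w)).

(* Main.v *)
Require Import Defs.
From Stdlib Require Import Reals.
From Coquelicot Require Import Coquelicot.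
From Stdlib Require Import Lra Lia Psatz Arith.
Open Scope R_scope.

(** Write [c n = mu n / n].  The frequencies [n] carrying [mu] are taken in
    pairs [(3k(j+1), 3k(j+1) + k)], [j >= 0], so sparse that the only products
    [c n * c (n + k)] that do not vanish are those of the two members of one
    pair.  Each such product is a number [a j] of either sign, and with [p j]
    and [q j] the values of [lambda2 _ k] at the two members,
      [K mu k w = sum_j a j * (p j / (p j ^ 2 + w ^ 2) + q j / (q j ^ 2 + w ^ 2))]
    ([K_paired_series]).  Putting [A j = a j * (p j + q j)], this is
    [sum_j A j * m j] where [m j] is a weighted mean of the values of the
    decreasing function [1 / (y ^ 2 + w ^ 2)] at [p j] and [q j]
    ([response]).  Since [p j] grows like [j ^ 2], the masses
    [B j], the integrals of [y ^ (- s - 1)] over the blocks [[p j, p (j + 1)]],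
    make such a sum a discretization of
    [int y ^ (- s - 1) / (y ^ 2 + w ^ 2) dy], which by homogeneity is a multiple
    of [w ^ (- 2 - s)].

    - For [s < 0], [A j = B j] works: every term is positive, the integral
      converges at the origin, and its part below [p 0] is only [O(w ^ (- 2))].
    - For [s = 0], the first pair alone gives a rate [w ^ (- 2)].
    - For [s > 0], the integral diverges at the origin, which reflects a term in
      [w ^ (- 2)] that has to be cancelled.  The masses [B j] with [j >= 1] are
      balanced by one opposite weight on the pair [0], of size
      [sum_(j >= 1) B j].  The response becomes
      [sum_(j >= 1) B j * (m 0 - m j)], whose terms are all positive because
      [m] decreases, and it behaves like
      [int y ^ (- s - 1) * (1 / w ^ 2 - 1 / (y ^ 2 + w ^ 2)) dy], again a
      multiple of [w ^ (- 2 - s)], convergent for [0 < s < 2].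

    In all cases the discretization error is bounded block by block, using only
    that [1 / (y ^ 2 + w ^ 2)] is monotone, by the increments of another
    primitive of the same kind, and so is smaller by a factor [w ^ (- 1 / 2)].
    The factor [eps] is carried by [a]. The regularity of [mu] follows from
    [a j = O(p j ^ (- s - 3 / 2))]; the index [s + 1 / 2] is reached for every
    [s], which is more than [s] when [s > 0]. *)

(** * Increments and powers *)

Lemma increment_le (F G F' G' : R -> R) (a b : R) :
  a <= b ->
  (forall x, a <= x <= b -> is_derive F x (F' x)) ->
  (forall x, a <= x <= b -> is_derive G x (G' x)) ->
  (forall x, a <= x <= b -> F' x <= G' x) ->
  F b - F a <= G b - G a.
Proof.
  intros hab hF hG hle.
  destruct (MVT_gen (fun x => G x - F x) a b (fun x => G' x - F' x))
    as [c [hc e]].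
  - rewrite Rmin_left, Rmax_right by lra. intros x hx.
    apply @is_derive_minus; [apply hG | apply hF]; lra.
  - rewrite Rmin_left, Rmax_right by lra. intros x hx.
    apply derivable_continuous_pt. exists (G' x - F' x).
    apply is_derive_Reals. apply @is_derive_minus; [apply hG | apply hF]; lra.
  - rewrite Rmin_left, Rmax_right in hc by lra.
    specialize (hle c hc). nra.
Qed.

Lemma is_derive_Rpower (c x : R) :
  0 < x -> is_derive (fun y => Rpower y c) x (c * Rpower x (c - 1)).
Proof. intros hx. apply is_derive_Reals, derivable_pt_lim_power, hx. Qed.

Lemma Rpower_gt0 (x c : R) : 0 < Rpower x c.
Proof. apply exp_pos. Qed.

Lemma Rpower_base_1 (c : R) : Rpower 1 c = 1.
Proof. unfold Rpower. now rewrite ln_1, Rmult_0_r, exp_0. Qed.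

Lemma Rpower_decr (x y c : R) :
  0 < x <= y -> c <= 0 -> Rpower y c <= Rpower x c.
Proof.
  intros hxy hc. replace c with (- (- c)) by ring.
  rewrite 2!(Rpower_Ropp _ (- c)).
  apply Rinv_le_contravar; [apply Rpower_gt0 | apply Rle_Rpower_l; lra].
Qed.

(** * Homogeneous primitives *)

(** The primitive vanishing at [0] of the integrand [x ^ (b - 1) / (x ^ 2 + 1)]
    of a Mellin transform; [A] is the full integral. The bound [x ^ b / b] comes
    from dropping [x ^ 2] in the denominator, and convergence at infinity from
    dropping [1]. *)
Lemma mellin_primitive (b : R) :
  0 < b < 2 ->
  exists (H : R -> R) (A : R), 0 < A /\
    (forall x, 0 < x -> is_derive H x (Rpower x (b - 1) / (x ^ 2 + 1))) /\
    (forall x, 0 < x -> 0 <= H x <= Rpower x b / b) /\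
    is_lim H p_infty A.
Proof.
  intros hb.
  set (h := fun x => Rpower x (b - 1) / (x ^ 2 + 1)).
  assert (hpos : forall x, 0 < h x).
  { intros x. apply Rdiv_lt_0_compat; [apply Rpower_gt0 | nra]. }
  assert (hc : forall x, 0 < x -> continuous h x).
  { intros x hx. apply @ex_derive_continuous.
    eexists. unfold h, Rpower. auto_derive; [|reflexivity].
    repeat split; try lra; nra. }
  set (H0 := (fun x => RInt h 1 x) : R -> R).
  assert (hH0 : forall x, 0 < x -> is_derive H0 x (h x)).
  { intros x hx. apply (is_derive_RInt h H0 1 x); [|now apply hc].
    exists (mkposreal x hx). intros y hy.
    apply (RInt_correct h 1 y). apply (ex_RInt_continuous h). intros z hz. apply hc.
    apply Rabs_def2 in hy. simpl in hy. unfold minus, plus, opp in hy.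
    simpl in hy.
    apply Rlt_le_trans with (2 := proj1 hz). apply Rmin_glb_lt; lra. }
  assert (mono : forall x y, 0 < x <= y -> H0 x <= H0 y).
  { intros x y hxy.
    generalize (increment_le (fun _ => 0) H0 (fun _ => 0) h x y).
    intros g. cut (0 - 0 <= H0 y - H0 x); [lra|]. apply g.
    - lra.
    - intros z _. apply @is_derive_const.
    - intros z hz. apply hH0; lra.
    - intros z _. left; apply hpos. }
  assert (up : forall x y, 0 < x <= y ->
                 H0 y - H0 x <= Rpower y b / b - Rpower x b / b).
  { intros x y hxy.
    apply (increment_le H0 (fun y => Rpower y b / b) h
             (fun y => Rpower y (b - 1))).
    - lra.
    - intros z hz. apply hH0; lra.
    - intros z hz. evar_last.
      + apply @is_derive_scal_l. apply is_derive_Rpower; lra.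
      + unfold scal; simpl; unfold mult; simpl. field; lra.
    - intros z hz. unfold h. apply Rle_div_l; [nra|].
      generalize (Rpower_gt0 z (b - 1)). nra. }
  assert (up2 : forall y, 1 <= y -> H0 y - H0 1 <= 1 / (2 - b)).
  { intros y hy.
    apply Rle_trans with
      (- Rpower y (b - 2) / (2 - b) - - Rpower 1 (b - 2) / (2 - b)).
    - apply (increment_le H0 (fun y => - Rpower y (b - 2) / (2 - b)) h
             (fun y => Rpower y (b - 2 - 1))).
      + lra.
      + intros z hz. apply hH0; lra.
      + intros z hz. evar_last.
        * apply @is_derive_scal_l. apply @is_derive_opp.
          apply is_derive_Rpower; lra.
        * unfold scal, opp; simpl; unfold mult; simpl. field; lra.
      + intros z hz. unfold h. apply Rle_div_l; [nra|].
        replace (b - 1) with ((b - 2 - 1) + INR 2) by (simpl; ring).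
        rewrite Rpower_plus, Rpower_pow by lra.
        generalize (Rpower_gt0 z (b - 2 - 1)). nra.
    - rewrite Rpower_base_1.
      generalize (Rpower_gt0 y (b - 2)). intros g.
      assert (0 <= Rpower y (b - 2) / (2 - b)).
      { apply Rdiv_le_0_compat; lra. }
      unfold Rdiv in *. lra. }
  (* infimum of [H0] at [0+], as minus a supremum *)
  destruct (completeness (fun v => exists x, 0 < x <= 1 /\ v = - H0 x))
    as [m [m1 m2]].
  { exists (Rpower 1 b / b - H0 1). intros v [x [hx ->]].
    specialize (up x 1 hx).
    assert (0 < Rpower x b / b).
    { apply Rdiv_lt_0_compat; [apply Rpower_gt0 | lra]. }
    lra. }
  { exists (- H0 1), 1. split; [lra | reflexivity]. }
  assert (hm : forall x, 0 < x -> 0 <= H0 x + m <= Rpower x b / b).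
  { intros x hx. split.
    - destruct (Rle_dec x 1) as [h1|h1].
      + generalize (m1 (- H0 x) (ex_intro _ x (conj (conj hx h1) eq_refl))). lra.
      + generalize (m1 (- H0 1)
          (ex_intro _ 1 (conj (conj Rlt_0_1 (Rle_refl 1)) eq_refl))).
        generalize (mono 1 x). lra.
    - cut (m <= Rpower x b / b - H0 x); [lra|]. apply m2.
      intros v [z [hz ->]].
      assert (hz0 : 0 < Rpower z b / b).
      { apply Rdiv_lt_0_compat; [apply Rpower_gt0 | lra]. }
      destruct (Rle_dec z x) as [h1|h1].
      + specialize (up z x). lra.
      + generalize (mono x z).
        assert (0 < Rpower x b / b).
        { apply Rdiv_lt_0_compat; [apply Rpower_gt0 | lra]. }
        lra. }
  destruct (completeness (fun v => exists x, 1 <= x /\ v = H0 x + m))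
    as [A [A1 A2]].
  { exists (H0 1 + 1 / (2 - b) + m). intros v [x [hx ->]].
    specialize (up2 x hx). lra. }
  { exists (H0 1 + m), 1. split; [lra | reflexivity]. }
  assert (hlt : H0 1 < H0 2).
  { destruct (MVT_gen H0 1 2 h) as [c [hc1 e]].
    - rewrite Rmin_left, Rmax_right by lra. intros x hx. apply hH0; lra.
    - rewrite Rmin_left, Rmax_right by lra. intros x hx.
      apply derivable_continuous_pt. exists (h x).
      apply is_derive_Reals, hH0; lra.
    - generalize (hpos c). nra. }
  exists (fun x => H0 x + m), A. split; [|split; [|split]].
  - assert (H0 2 + m <= A) by (apply A1; exists 2; split; [lra|reflexivity]).
    specialize (hm 1). lra.
  - intros x hx. evar_last.
    + apply @is_derive_plus; [now apply hH0 | apply @is_derive_const].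
    + apply Rplus_0_r.
  - exact hm.
  - apply is_lim_spec. intros e.
    assert (ex : exists x0, 1 <= x0 /\ A - e < H0 x0 + m).
    { destruct (Classical_Prop.classic
        (exists x0, 1 <= x0 /\ A - e < H0 x0 + m)) as [|n]; [assumption|].
      exfalso. assert (A <= A - e).
      { apply A2. intros v [x [hx ->]]. apply Rnot_lt_le. intros l.
        apply n. now exists x. }
      generalize (cond_pos e). lra. }
    destruct ex as [x0 [hx0 l]]. exists x0. intros x hx.
    assert (H0 x + m <= A) by (apply A1; exists x; split; [lra|reflexivity]).
    specialize (mono x0 x). apply Rabs_def1; generalize (cond_pos e); lra.
Qed.

(** The substitution [y = w x]: this is where the exact power of [w] in the
    asymptotics comes from. *)
Lemma scaled_primitive (b : R) :
  0 < b < 2 ->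
  exists A : R, 0 < A /\ forall w, 0 < w ->
    exists M : R -> R,
      (forall y, 0 < y -> is_derive M y (Rpower y (b - 1) / (y ^ 2 + w ^ 2))) /\
      (forall y, 0 < y -> 0 <= M y <= Rpower y b / b / w ^ 2) /\
      is_lim M p_infty (A * Rpower w (b - 2)).
Proof.
  intros hb. destruct (mellin_primitive b hb) as [H [A [hA [hd [hbd hl]]]]].
  exists A. split; [exact hA|]. intros w hw.
  exists (fun y => Rpower w (b - 2) * H (y / w)).
  assert (hyw : forall y, 0 < y -> 0 < y / w).
  { intros y hy. now apply Rdiv_lt_0_compat. }
  assert (split_pow : forall y c, 0 < y ->
    Rpower (y / w) c * Rpower w c = Rpower y c).
  { intros y c hy. rewrite Rpower_mult_distr by auto.
    f_equal. field; lra. }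
  split; [|split].
  - intros y hy. evar_last.
    + apply @is_derive_scal. apply @is_derive_comp.
      * apply hd; auto.
      * auto_derive; [exact I | reflexivity].
    + unfold scal; simpl; unfold mult; simpl.
      rewrite <- (split_pow y (b - 1) hy).
      assert (e : Rpower w (b - 1) = Rpower w (b - 2) * w).
      { rewrite <- (Rpower_1 w) at 3 by lra. rewrite <- Rpower_plus.
        f_equal; ring. }
      rewrite e.
      field. repeat split; nra.
  - intros y hy. split.
    { apply Rmult_le_pos; [left; apply Rpower_gt0 | apply hbd; auto]. }
    apply Rle_trans with (Rpower w (b - 2) * (Rpower (y / w) b / b)).
    + apply Rmult_le_compat_l; [left; apply Rpower_gt0 | apply hbd; auto].
    + right. rewrite <- (split_pow y b hy).
      assert (e : Rpower w b = Rpower w (b - 2) * w ^ 2).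
      { rewrite <- Rpower_pow by lra. rewrite <- Rpower_plus.
        f_equal; simpl; ring. }
      rewrite e.
      field. lra.
  - apply is_lim_ext with (fun y => H (y / w) * Rpower w (b - 2)).
    { intros y; ring. }
    apply (is_lim_scal_r (fun y => H (y / w)) (Rpower w (b - 2)) p_infty A).
    apply (is_lim_comp H (fun y => y / w) p_infty (Finite A) p_infty).
    + exact hl.
    + apply is_lim_spec. intros B. exists (B * w). intros y hy.
      now apply Rlt_div_r.
    + exists 0. discriminate.
Qed.

(** * Series *)

Lemma is_series_telescope (u : nat -> R) (l : R) :
  is_lim_seq u l -> is_series (fun j => u (S j) - u j) (l - u O).
Proof.
  intros hu.
  assert (e : forall n, u (S n) - u O = sum_n (fun j => u (S j) - u j) n).
  { induction n as [|n IH].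
    - now rewrite sum_O.
    - rewrite sum_Sn, <- IH. unfold plus; simpl. ring. }
  apply (is_lim_seq_ext _ _ (l - u O) e).
  apply is_lim_seq_minus'; [|apply is_lim_seq_const].
  now apply is_lim_seq_incr_1 in hu.
Qed.

(** Comparison of a series with a reference one when the error is dominated by a
    third: the form in which a sum is compared with an integral cut into blocks. *)
Lemma Series_near (a b c : nat -> R) (lb lc : R) :
  (forall j, Rabs (a j - b j) <= c j) ->
  is_series b lb -> is_series c lc ->
  ex_series a /\ Rabs (Series a - lb) <= lc.
Proof.
  intros h hb hc.
  assert (habs : ex_series (fun j => Rabs (a j - b j))).
  { apply (ex_series_le (K := R_AbsRing) (V := R_CompleteNormedModule) _ c).
    - intros j. unfold norm; simpl. unfold abs; simpl. now rewrite Rabs_Rabsolu.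
    - now exists lc. }
  assert (hd : ex_series (fun j => a j - b j)) by now apply ex_series_Rabs.
  assert (hea : is_series a (Series (fun j => a j - b j) + lb)).
  { apply is_series_ext with (fun j => (a j - b j) + b j).
    - intros j. change (@eq R (a j - b j + b j) (a j)). ring.
    - apply (is_series_plus (V := R_NormedModule)); [|exact hb].
      now apply Series_correct. }
  split; [now eexists; apply hea|].
  rewrite (is_series_unique _ _ hea).
  replace (Series (fun j => a j - b j) + lb - lb)
    with (Series (fun j => a j - b j)) by ring.
  apply Rle_trans with (1 := Series_Rabs _ habs).
  rewrite <- (is_series_unique _ _ hc).
  apply Series_le; [|now exists lc].
  intros j. split; [apply Rabs_pos | apply h].
Qed.

Lemma Series_gt0 (a : nat -> R) :
  (forall j, 0 < a j) -> ex_series a -> 0 < Series a.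
Proof.
  intros ha he. rewrite Series_incr_1 by assumption.
  apply Rlt_le_trans with (a O + 0); [generalize (ha O); lra|].
  apply Rplus_le_compat_l.
  rewrite <- (Rmult_0_l (Series (fun j => a (S j)))), <- Series_scal_l.
  apply Series_le.
  - intros j. generalize (ha (S j)). lra.
  - now apply -> (ex_series_incr_1 a).
Qed.

Lemma is_series_single (a : nat -> R) :
  (forall j, a (S j) = 0) -> is_series a (a O).
Proof.
  intros h. change (is_lim_seq (sum_n a) (a O)).
  apply is_lim_seq_ext with (fun _ => a O); [|apply is_lim_seq_const].
  induction n as [|n IH]; [now rewrite sum_O|].
  rewrite sum_Sn, <- IH, h. symmetry. apply Rplus_0_r.
Qed.

(** The partial sums of [t] are, up to repetitions, those of the subseries. *)
Lemma is_series_sparse (t : nat -> R) (f : nat -> nat) (l : R) :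
  (forall j, (f j < f (S j))%nat) ->
  (forall i, (forall j, i <> f j) -> t i = 0) ->
  is_series (fun j => t (f j)) l -> is_series t l.
Proof.
  intros hf ht hs.
  assert (mono : forall i j, (i < j)%nat -> (f i < f j)%nat).
  { intros i j hij. induction hij as [|j hij IH]; [apply hf|].
    specialize (hf j). lia. }
  (* [J] counts the points of the range of [f] that are below [N]. *)
  (* Both sums start with a dummy term, so that empty sums are covered. *)
  assert (count : forall N, exists J,
    (forall j, (j < J)%nat -> (f j < N)%nat) /\ (N <= f J)%nat /\
    sum_f_R0 (fun i => match i with O => 0 | S i => t i end) N =
    sum_f_R0 (fun j => match j with O => 0 | S j => t (f j) end) J).
  { induction N as [|N [J [h1 [h2 h3]]]].
    - exists O. repeat split; [lia | lia].
    - destruct (Nat.eq_dec N (f J)) as [e|n].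
      + exists (S J). split; [|split].
        * intros j hj. destruct (Nat.eq_dec j J) as [->|]; [lia|].
          specialize (h1 j). lia.
        * specialize (hf J). lia.
        * simpl. rewrite h3, e. reflexivity.
      + exists J. split; [|split].
        * intros j hj. specialize (h1 j hj). lia.
        * lia.
        * simpl. rewrite h3, ht; [ring|].
          intros j ->. destruct (Nat.lt_total j J) as [h|[->|h]].
          -- specialize (h1 j h). lia.
          -- lia.
          -- specialize (mono J j h). lia. }
  assert (shift : forall (u : nat -> R) N,
    sum_f_R0 (fun i => match i with O => 0 | S i => u i end) (S N) =
    sum_n u N).
  { intros u N. induction N as [|N IH].
    - rewrite sum_O. simpl. ring.
    - rewrite sum_Sn, <- IH. reflexivity. }
  change (is_lim_seq (sum_n t) l).
  change (is_lim_seq (sum_n (fun j => t (f j))) l) in hs.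
  apply is_lim_seq_spec. intros e.
  apply is_lim_seq_spec in hs. destruct (hs e) as [J0 hJ0].
  exists (f (S J0)). intros N hN.
  destruct (count (S N)) as [J [_ [h2 h3]]].
  assert (hJ : (S J0 < J)%nat).
  { destruct (Nat.le_gt_cases J (S J0)) as [h|h]; [|exact h].
    destruct (Nat.eq_dec J (S J0)) as [->|]; [lia|].
    specialize (mono J (S J0)). lia. }
  rewrite shift in h3. rewrite h3.
  destruct J as [|J]; [lia|]. rewrite shift. apply hJ0. lia.
Qed.
(** * Interlaced levels and their means *)

(** What the asymptotic analysis needs of the levels: [p j] is at least quadratic
    in [j], the pairs interlace, and successive gaps are of the order of
    [sqrt (p j)], as for the eigenvalues of the Laplacian. *)
Record spectral_pairs (p q : nat -> R) (C : R) : Prop := {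
  sp_growth : forall j, (INR j + 2) ^ 2 <= p j;
  sp_order : forall j, p j < q j < p (S j);
  sp_ratio : forall j, p (S j) <= 5 * p j;
  sp_gap : forall j, p (S j) - p j <= C * sqrt (p j) }.

Lemma sp_ge4 p q C j : spectral_pairs p q C -> 4 <= p j.
Proof. intros h. generalize (sp_growth _ _ _ h j) (pos_INR j). nra. Qed.

Lemma sp_infty p q C : spectral_pairs p q C -> is_lim_seq p p_infty.
Proof.
  intros h. apply is_lim_seq_le_p_loc with INR; [|apply is_lim_seq_INR].
  exists O. intros j _. generalize (sp_growth _ _ _ h j) (pos_INR j). nra.
Qed.

Lemma sp_gap_constant_ge0 p q C : spectral_pairs p q C -> 0 <= C.
Proof.
  intros h.
  assert (h4 := sp_ge4 _ _ _ O h). assert (ho := sp_order _ _ _ h O).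
  assert (hg := sp_gap _ _ _ h O).
  assert (0 < sqrt (p O)) by (apply sqrt_lt_R0; lra). nra.
Qed.

Definition resolvent (w y : R) : R := / (y ^ 2 + w ^ 2).

(** The mean of [resolvent w] at [p] and [q] with weights [p / (p + q)] and
    [q / (p + q)]. *)
Definition pair_mean (w p q : R) : R :=
  (p / (p ^ 2 + w ^ 2) + q / (q ^ 2 + w ^ 2)) / (p + q).

Lemma resolvent_gt0 w y : 0 < y -> 0 < resolvent w y.
Proof. intros hy. apply Rinv_0_lt_compat. nra. Qed.

Lemma resolvent_decr w x y : 0 < x <= y -> resolvent w y <= resolvent w x.
Proof. intros h. apply Rinv_le_contravar; nra. Qed.

Lemma resolvent_decr_strict w x y : 0 < x < y -> resolvent w y < resolvent w x.
Proof. intros h. apply Rinv_lt_contravar; [apply Rmult_lt_0_compat|]; nra. Qed.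

Lemma pair_mean_bounds w p q :
  0 < p < q -> resolvent w q <= pair_mean w p q <= resolvent w p.
Proof.
  intros h. unfold pair_mean.
  assert (g := resolvent_decr w p q ltac:(lra)).
  unfold resolvent in g. unfold Rdiv.
  split; [apply Rle_div_r | apply Rle_div_l]; try lra; unfold resolvent; nra.
Qed.

Lemma resolvent_le w y : 0 < y -> resolvent w y <= / y ^ 2.
Proof. intros hy. apply Rinv_le_contravar; nra. Qed.

(** * Masses of the blocks *)

(** The integral of [y ^ (- s - 1)] over the block [[p j, p (j + 1)]]. *)
Definition block_mass (s : R) (p : nat -> R) (j : nat) : R :=
  (Rpower (p j) (- s) - Rpower (p (S j)) (- s)) / s.

(** The mean value inequality for an integral with weight [y ^ (- s - 1)], the
    integral being given by a primitive [M]. *)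
Lemma block_mass_sandwich (s : R) p q C j (M : R -> R) (g : R -> R) (lo hi : R) :
  spectral_pairs p q C -> s <> 0 ->
  (forall y, p j <= y <= p (S j) ->
     is_derive M y (Rpower y (- s - 1) * g y)) ->
  (forall y, p j <= y <= p (S j) -> lo <= g y <= hi) ->
  lo * block_mass s p j <= M (p (S j)) - M (p j) <= hi * block_mass s p j.
Proof.
  intros h hs hM hg.
  assert (h4 := sp_ge4 _ _ _ j h). assert (ho := sp_order _ _ _ h j).
  assert (hT : forall c y, p j <= y <= p (S j) ->
    is_derive (fun y => c * (- Rpower y (- s) / s)) y
              (Rpower y (- s - 1) * c)).
  { intros c y hy. evar_last.
    - apply @is_derive_scal. apply @is_derive_scal_l. apply @is_derive_opp.
      apply is_derive_Rpower. lra.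
    - unfold scal, opp; simpl; unfold mult; simpl. field; lra. }
  assert (e : forall c, c * block_mass s p j =
    c * (- Rpower (p (S j)) (- s) / s) - c * (- Rpower (p j) (- s) / s)).
  { intros c. unfold block_mass. field; lra. }
  split; rewrite e.
  - apply (increment_le (fun y => lo * (- Rpower y (- s) / s)) M
             (fun y => Rpower y (- s - 1) * lo)
             (fun y => Rpower y (- s - 1) * g y)); auto; [lra|].
    intros y hy. apply Rmult_le_compat_l; [left; apply Rpower_gt0|].
    now apply hg.
  - apply (increment_le M (fun y => hi * (- Rpower y (- s) / s))
             (fun y => Rpower y (- s - 1) * g y)
             (fun y => Rpower y (- s - 1) * hi)); auto; [lra|].
    intros y hy. apply Rmult_le_compat_l; [left; apply Rpower_gt0|].
    now apply hg.
Qed.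

Lemma block_mass_gt0 s p q C j :
  spectral_pairs p q C -> s <> 0 -> 0 < block_mass s p j.
Proof.
  intros h hs.
  assert (h4 := sp_ge4 _ _ _ j h). assert (ho := sp_order _ _ _ h j).
  (* The primitive is the identity: the integrand is [y ^ (- s - 1)] times its
     inverse, and the increment is positive. *)
  destruct (block_mass_sandwich s p q C j (fun y => y)
    (fun y => / Rpower y (- s - 1)) 0
    (Rmax (/ Rpower (p j) (- s - 1)) (/ Rpower (p (S j)) (- s - 1)))
    h hs) as [_ hup].
  - intros y hy. rewrite Rinv_r; [apply @is_derive_id|].
    generalize (Rpower_gt0 y (- s - 1)). lra.
  - intros y hy. split.
    + left. apply Rinv_0_lt_compat, Rpower_gt0.
    + rewrite <- !Rpower_Ropp.
      destruct (Rle_dec 0 (- (- s - 1))) as [c|c].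
      * apply Rle_trans with (2 := Rmax_r _ _). apply Rle_Rpower_l; lra.
      * apply Rle_trans with (2 := Rmax_l _ _). apply Rpower_decr; lra.
  - assert (hm : 0 < Rmax (/ Rpower (p j) (- s - 1)) (/ Rpower (p (S j)) (- s - 1))).
    { apply Rlt_le_trans with (2 := Rmax_l _ _).
      apply Rinv_0_lt_compat, Rpower_gt0. }
    nra.
Qed.

(** The length of the block is at most [C * sqrt (p j)], and the weight
    [y ^ (- s - 1)] decreases. *)
Lemma block_mass_le s p q C j :
  spectral_pairs p q C -> s <> 0 -> -1 <= s ->
  block_mass s p j <= C * Rpower (p j) (- s - 1 / 2).
Proof.
  intros h hs hs1.
  assert (h4 := sp_ge4 _ _ _ j h). assert (ho := sp_order _ _ _ h j).
  assert (hP := fun y => Rpower_gt0 y (- s - 1)).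
  destruct (block_mass_sandwich s p q C j (fun y => Rpower (p j) (- s - 1) * y)
    (fun y => Rpower (p j) (- s - 1) / Rpower y (- s - 1)) 1
    (Rpower (p j) (- s - 1) / Rpower (p (S j)) (- s - 1)) h hs) as [hlo _].
  - intros y hy. evar_last.
    + apply @is_derive_scal. apply @is_derive_id.
    + unfold one; simpl. field. generalize (hP y). lra.
  - intros y hy. split.
    + apply Rle_div_r; [apply hP|]. rewrite Rmult_1_l.
      apply Rpower_decr; lra.
    + apply Rmult_le_compat_l; [left; apply hP|].
      apply Rinv_le_contravar; [apply hP|]. apply Rpower_decr; lra.
  - rewrite Rmult_1_l in hlo. apply Rle_trans with (1 := hlo).
    rewrite <- Rmult_minus_distr_l.
    replace (- s - 1 / 2) with (- s - 1 + / 2) by field.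
    rewrite Rpower_plus, Rpower_sqrt by lra.
    generalize (sp_gap _ _ _ h j) (hP (p j)). nra.
Qed.

(** Factor the difference: [p (j + 1) - p j] is at most [C * sqrt (p j)] and
    [p (j + 1) + p j] at most [6 * p j]. *)
Lemma resolvent_gap w p q C j :
  spectral_pairs p q C ->
  resolvent w (p j) - resolvent w (p (S j)) <=
  6 * C * (Rpower (p j) (3 / 2) * resolvent w (p j) * resolvent w (p (S j))).
Proof.
  intros h.
  assert (h4 := sp_ge4 _ _ _ j h). assert (ho := sp_order _ _ _ h j).
  assert (hr := sp_ratio _ _ _ h j). assert (hg := sp_gap _ _ _ h j).
  assert (e : resolvent w (p j) - resolvent w (p (S j)) =
    (p (S j) - p j) * (p (S j) + p j) * (resolvent w (p j) * resolvent w (p (S j)))).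
  { unfold resolvent. field. split; nra. }
  replace (6 * C *
    (Rpower (p j) (3 / 2) * resolvent w (p j) * resolvent w (p (S j))))
    with (6 * C * Rpower (p j) (3 / 2) *
          (resolvent w (p j) * resolvent w (p (S j)))) by ring.
  rewrite e.
  apply Rmult_le_compat_r.
  { apply Rmult_le_pos; left; apply resolvent_gt0; lra. }
  replace (3 / 2) with (/ 2 + 1) by field.
  rewrite Rpower_plus, Rpower_sqrt, Rpower_1 by lra.
  assert (hs := sqrt_pos (p j)). nra.
Qed.

(** Both quantities lie between the masses of the block for the values of
    [resolvent w] at its two ends. The constant [c] is [0] or [- / w ^ 2]. *)
Lemma mass_mean_close s w p q C j (M : R -> R) c :
  spectral_pairs p q C -> s <> 0 ->
  (forall y, 0 < y ->
     is_derive M y (Rpower y (- s - 1) * (c + resolvent w y))) ->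
  Rabs (block_mass s p j * (c + pair_mean w (p j) (q j)) - (M (p (S j)) - M (p j)))
  <= 6 * C * (block_mass s p j *
       (Rpower (p j) (3 / 2) * resolvent w (p j) * resolvent w (p (S j)))).
Proof.
  intros h hs hM.
  assert (h4 := sp_ge4 _ _ _ j h). assert (ho := sp_order _ _ _ h j).
  assert (hB := block_mass_gt0 s p q C j h hs).
  assert (hm := pair_mean_bounds w (p j) (q j) ltac:(lra)).
  assert (hq := resolvent_decr w (q j) (p (S j)) ltac:(lra)).
  assert (hgap := resolvent_gap w p q C j h).
  destruct (block_mass_sandwich s p q C j M (fun y => c + resolvent w y)
    (c + resolvent w (p (S j))) (c + resolvent w (p j)) h hs) as [h1 h2].
  - intros y hy. apply hM. lra.
  - intros y hy. split; apply Rplus_le_compat_l; apply resolvent_decr; lra.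
  - apply Rle_trans with
      (block_mass s p j * (resolvent w (p j) - resolvent w (p (S j)))).
    + apply Rabs_le. nra.
    + rewrite <- Rmult_assoc, (Rmult_comm (6 * C)), Rmult_assoc.
      apply Rmult_le_compat_l; lra.
Qed.

(** [p j] grows at least like [(j + 1) * (j + 2)], whose inverses telescope. *)
Lemma ex_series_of_bound (p q : nat -> R) C D (a : nat -> R) :
  spectral_pairs p q C -> (forall j, Rabs (a j) <= D / p j) -> ex_series a.
Proof.
  intros h ha.
  assert (hs : is_series
    (fun j => - D / (INR (S j) + 1) - (- D / (INR j + 1))) (0 - (- D / (INR 0 + 1)))).
  { apply (is_series_telescope (fun j => - D / (INR j + 1))).
    apply is_lim_seq_ext with (fun j => - D * / INR (S j)).
    { intros j. now rewrite S_INR. }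
    replace (Finite 0) with (Rbar_mult (- D) (Rbar_inv p_infty)).
    2: { simpl. f_equal. ring. }
    apply is_lim_seq_scal_l. apply is_lim_seq_inv; [|discriminate].
    apply (is_lim_seq_incr_1 INR). apply is_lim_seq_INR. }
  apply (ex_series_le (K := R_AbsRing) (V := R_CompleteNormedModule)) with
    (2 := ex_intro _ _ hs).
  intros j. apply Rle_trans with (1 := ha j).
  assert (hj := pos_INR j). assert (hg := sp_growth _ _ _ h j).
  assert (hD : 0 <= D).
  { generalize (ha j) (Rabs_pos (a j)). intros g1 g2.
    apply Rmult_le_reg_r with (/ p j); [apply Rinv_0_lt_compat; nra|].
    unfold Rdiv in g1. lra. }
  rewrite S_INR.
  replace (- D / (INR j + 1 + 1) - - D / (INR j + 1))
    with (D * / ((INR j + 1) * (INR j + 2))) by (field; lra).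
  apply Rmult_le_compat_l; [exact hD|].
  apply Rinv_le_contravar; nra.
Qed.

Lemma weighted_le s p q C D A j :
  spectral_pairs p q C -> -1 <= s -> 0 <= D ->
  Rabs A <= D * Rpower (p j) (- s - 1 / 2) -> Rabs A <= D * p j.
Proof.
  intros h hs hD hA. apply Rle_trans with (1 := hA).
  assert (h4 := sp_ge4 _ _ _ j h).
  apply Rmult_le_compat_l; [exact hD|].
  rewrite <- (Rpower_1 (p j)) at 2 by lra.
  apply Rle_Rpower; lra.
Qed.

Lemma ex_series_mean s p q C D (A : nat -> R) w :
  spectral_pairs p q C -> -1 <= s -> 0 <= D ->
  (forall j, Rabs (A j) <= D * Rpower (p j) (- s - 1 / 2)) ->
  ex_series (fun j => A j * pair_mean w (p j) (q j)).
Proof.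
  intros h hs hD hA. apply (ex_series_of_bound p q C D _ h). intros j.
  assert (h4 := sp_ge4 _ _ _ j h). assert (ho := sp_order _ _ _ h j).
  assert (hm := pair_mean_bounds w (p j) (q j) ltac:(lra)).
  assert (hr := resolvent_le w (p j) ltac:(lra)).
  assert (hq := resolvent_gt0 w (q j) ltac:(lra)).
  assert (h1 := weighted_le s p q C D (A j) j h hs hD (hA j)).
  rewrite Rabs_mult, (Rabs_right (pair_mean _ _ _)) by lra.
  apply Rle_trans with (D * p j * / p j ^ 2).
  - apply Rmult_le_compat; [apply Rabs_pos | lra | exact h1 | lra].
  - right. field. lra.
Qed.

(** * Weights with a prescribed response *)

Definition response (p q A : nat -> R) (w : R) : R :=
  Series (fun j => A j * pair_mean w (p j) (q j)).

(** The bound on [A] is what the regularity of [mu] amounts to. *)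
Definition realizes_rate (s : R) (p q A : nat -> R) : Prop :=
  (exists D, 0 <= D /\ forall j, Rabs (A j) <= D * Rpower (p j) (- s - 1 / 2)) /\
  (forall w, 0 < response p q A w) /\
  (exists alpha nu c, 0 < alpha /\ 0 < nu <= 2 /\ forall w, 1 <= w ->
     Rabs (response p q A w - alpha * Rpower w (- (2 + s)))
     <= c * Rpower w (- (2 + s + nu))).

Lemma Rpower_half_3 (x : R) : 0 < x -> Rpower x (3 / 2) = x * sqrt x.
Proof.
  intros hx. replace (3 / 2) with (1 + / 2) by field.
  now rewrite Rpower_plus, Rpower_sqrt, Rpower_1 by lra.
Qed.

(** Young's inequality [y ^ (3 / 2) * w ^ (1 / 2) <= y ^ 2 + w ^ 2], which turns
    the gap estimate into a gain of [w ^ (- 1 / 2)]. *)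
Lemma resolvent_interpolation w y :
  0 < w -> 0 < y -> Rpower y (3 / 2) * resolvent w y <= Rpower w (- (1 / 2)).
Proof.
  intros hw hy. rewrite Rpower_half_3 by lra.
  replace (1 / 2) with (/ 2) by field.
  rewrite Rpower_Ropp, Rpower_sqrt by lra.
  assert (hsw := sqrt_lt_R0 w hw). assert (hsy := sqrt_lt_R0 y hy).
  assert (ew := sqrt_sqrt w ltac:(lra)). assert (ey := sqrt_sqrt y ltac:(lra)).
  unfold resolvent.
  apply Rle_div_l; [nra|].
  apply Rmult_le_reg_l with (sqrt w); [lra|].
  replace (sqrt w * (/ sqrt w * (y ^ 2 + w ^ 2))) with (y ^ 2 + w ^ 2)
    by (field; lra).
  assert (2 * (sqrt w * sqrt y) <= w + y)
    by (generalize (pow2_ge_0 (sqrt w - sqrt y)); nra).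
  replace (sqrt w * (y * sqrt y)) with (y * (sqrt w * sqrt y)) by ring.
  apply Rle_trans with (y * ((w + y) / 2)); [|nra].
  apply Rmult_le_compat_l; lra.
Qed.

Lemma Rpower_neg_nat w n : 0 < w -> / w ^ n = Rpower w (- INR n).
Proof. intros hw. now rewrite Rpower_Ropp, Rpower_pow. Qed.

(** The errors are compared with the increments of the primitive [M] that gives
    the main term; the other loss is the part [M (p 0)] of the integral below
    the first level. *)
Lemma rate_negative s p q C :
  spectral_pairs p q C -> -1 <= s < 0 ->
  realizes_rate s p q (block_mass s p).
Proof.
  intros h hs.
  assert (hB := fun j => block_mass_gt0 s p q C j h ltac:(lra)).
  assert (hC := sp_gap_constant_ge0 p q C h).
  assert (hD : forall j,
    Rabs (block_mass s p j) <= C * Rpower (p j) (- s - 1 / 2)).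
  { intros j. rewrite Rabs_right by (left; apply hB).
    apply (block_mass_le s p q); [exact h | lra | lra]. }
  split; [now exists C | split].
  - intros w. apply Series_gt0.
    + intros j. apply Rmult_lt_0_compat; [apply hB|].
      assert (h4 := sp_ge4 _ _ _ j h). assert (ho := sp_order _ _ _ h j).
      generalize (pair_mean_bounds w (p j) (q j) ltac:(lra))
        (resolvent_gt0 w (q j) ltac:(lra)). lra.
    + apply (ex_series_mean s p q C C); auto; lra.
  - destruct (scaled_primitive (- s)) as [alpha [ha HM]]; [lra|].
    exists alpha, (Rmin (1 / 2) (- s)),
      (6 * C * alpha + Rpower (p O) (- s) / - s).
    split; [exact ha | split].
    { split; [apply Rmin_glb_lt; lra|].
      apply Rle_trans with (1 := Rmin_l _ _). lra. }
    intros w hw. destruct (HM w ltac:(lra)) as [M [hM [hM0 hMl]]].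
    set (L := alpha * Rpower w (- s - 2)) in *.
    assert (hser : is_series (fun j => M (p (S j)) - M (p j)) (L - M (p O))).
    { apply (is_series_telescope (fun j => M (p j)) L).
      apply (is_lim_comp_seq M p p_infty L hMl); [now exists O|].
      exact (sp_infty _ _ _ h). }
    destruct (Series_near (fun j => block_mass s p j * pair_mean w (p j) (q j))
      (fun j => M (p (S j)) - M (p j))
      (fun j => 6 * C * Rpower w (- (1 / 2)) * (M (p (S j)) - M (p j)))
      (L - M (p O)) (6 * C * Rpower w (- (1 / 2)) * (L - M (p O)))) as [_ hn].
    + intros j.
      assert (h4 := sp_ge4 _ _ _ j h). assert (ho := sp_order _ _ _ h j).
      assert (hd : forall y, 0 < y ->
        is_derive M y (Rpower y (- s - 1) * (0 + resolvent w y))).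
      { intros y hy. rewrite Rplus_0_l. now apply hM. }
      assert (hc := mass_mean_close s w p q C j M 0 h ltac:(lra) hd).
      rewrite Rplus_0_l in hc. apply Rle_trans with (1 := hc).
      rewrite (Rmult_assoc (6 * C) (Rpower w _)).
      apply Rmult_le_compat_l; [lra|].
      destruct (block_mass_sandwich s p q C j M (resolvent w)
        (resolvent w (p (S j))) (resolvent w (p j)) h ltac:(lra)) as [h1 _].
      * intros y hy. apply hM. lra.
      * intros y hy. split; apply resolvent_decr; lra.
      * apply Rle_trans with
          (Rpower w (- (1 / 2)) * (resolvent w (p (S j)) * block_mass s p j)).
        -- rewrite (Rmult_comm (resolvent w (p (S j)))), <- !Rmult_assoc.
           apply Rmult_le_compat_r; [left; apply resolvent_gt0; lra|].
           rewrite (Rmult_assoc (block_mass s p j)), (Rmult_comm (Rpower w _)).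
           apply Rmult_le_compat_l; [left; apply hB|].
           apply resolvent_interpolation; lra.
        -- apply Rmult_le_compat_l; [left; apply Rpower_gt0 | exact h1].
    + exact hser.
    + apply (is_series_scal (K := R_AbsRing) (V := R_NormedModule)
        (6 * C * Rpower w (- (1 / 2))) _ _ hser).
    + fold (response p q (block_mass s p) w) in hn.
      assert (h4 := sp_ge4 _ _ _ O h).
      destruct (hM0 (p O) ltac:(lra)) as [m1 m2].
      replace (- (2 + s)) with (- s - 2) by ring. fold L.
      set (r := response p q (block_mass s p) w) in *.
      apply Rle_trans with (6 * C * (Rpower w (- (1 / 2)) * L) + M (p O)).
      * assert (hx : 0 <= 6 * C * Rpower w (- (1 / 2)) * M (p O)).
        { apply Rmult_le_pos; [|exact m1]. apply Rmult_le_pos; [lra|].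
          left; apply Rpower_gt0. }
        apply Rabs_le_between in hn. apply Rabs_le. nra.
      * rewrite Rmult_plus_distr_r. apply Rplus_le_compat.
        -- rewrite (Rmult_assoc (6 * C) alpha).
           apply Rmult_le_compat_l; [lra|]. unfold L.
           rewrite <- Rmult_assoc, (Rmult_comm (Rpower w _) alpha), Rmult_assoc.
           apply Rmult_le_compat_l; [lra|].
           rewrite <- Rpower_plus. apply Rle_Rpower; [lra|].
           generalize (Rmin_l (1 / 2) (- s)). lra.
        -- apply Rle_trans with (1 := m2).
           apply Rmult_le_compat_l.
           { left. apply Rdiv_lt_0_compat; [apply Rpower_gt0 | lra]. }
           rewrite Rpower_neg_nat by lra. apply Rle_Rpower; [lra|].
           generalize (Rmin_r (1 / 2) (- s)). simpl. lra.
Qed.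

Lemma pair_mean_defect w p q :
  0 < w -> 0 < p < q ->
  0 <= / w ^ 2 - pair_mean w p q <= q ^ 2 * / w ^ 4.
Proof.
  intros hw hpq. assert (hm := pair_mean_bounds w p q hpq).
  assert (e : forall y, 0 < y ->
    / w ^ 2 - resolvent w y = / w ^ 2 * (y ^ 2 * resolvent w y)).
  { intros y hy. unfold resolvent. field. split; nra. }
  assert (ep := e p ltac:(lra)). assert (eq := e q ltac:(lra)).
  assert (hp := resolvent_gt0 w p ltac:(lra)).
  assert (hq := resolvent_gt0 w q ltac:(lra)).
  assert (hw2 : 0 < / w ^ 2) by (apply Rinv_0_lt_compat; nra).
  assert (hq2 : resolvent w q <= / w ^ 2) by (apply Rinv_le_contravar; nra).
  replace (/ w ^ 4) with (/ w ^ 2 * / w ^ 2) by (field; lra).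
  split.
  - assert (0 <= / w ^ 2 * (p ^ 2 * resolvent w p)).
    { apply Rmult_le_pos; [lra|]. apply Rmult_le_pos; nra. }
    lra.
  - apply Rle_trans with (/ w ^ 2 * (q ^ 2 * resolvent w q)); [lra|].
    rewrite <- Rmult_assoc, (Rmult_comm _ (q ^ 2)), Rmult_assoc.
    apply Rmult_le_compat_l; [nra|]. apply Rmult_le_compat_l; lra.
Qed.

Definition head_weight (a : R) (j : nat) : R :=
  match j with O => a | S _ => 0 end.

Lemma rate_zero p q C :
  spectral_pairs p q C -> realizes_rate 0 p q (head_weight 1).
Proof.
  intros h.
  assert (h4 := sp_ge4 _ _ _ O h). assert (ho := sp_order _ _ _ h O).
  assert (e : forall w, response p q (head_weight 1) w = pair_mean w (p O) (q O)).
  { intros w. unfold response. rewrite <- (Rmult_1_l (pair_mean w _ _)).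
    apply is_series_unique.
    apply (is_series_single
      (fun j => head_weight 1 j * pair_mean w (p j) (q j))).
    intros j. simpl. ring. }
  split; [|split].
  - exists (/ Rpower (p O) (- 0 - 1 / 2)).
    assert (hP := Rpower_gt0 (p O) (- 0 - 1 / 2)).
    split; [left; now apply Rinv_0_lt_compat|].
    intros [|j]; simpl.
    + rewrite Rabs_R1. right. field. lra.
    + rewrite Rabs_R0. apply Rmult_le_pos; left.
      * now apply Rinv_0_lt_compat.
      * apply Rpower_gt0.
  - intros w. rewrite e.
    generalize (pair_mean_bounds w (p O) (q O) ltac:(lra))
      (resolvent_gt0 w (q O) ltac:(lra)). lra.
  - exists 1, 2, (q O ^ 2). split; [lra | split; [lra|]]. intros w hw.
    rewrite e.
    replace (- (2 + 0)) with (- INR 2) by (simpl; ring).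
    replace (- (2 + 0 + 2)) with (- INR 4) by (simpl; ring).
    rewrite <- !Rpower_neg_nat by lra.
    generalize (pair_mean_defect w (p O) (q O) ltac:(lra) ltac:(lra)). intros g.
    apply Rabs_le. lra.
Qed.

Lemma spectral_pairs_shift p q C :
  spectral_pairs p q C ->
  spectral_pairs (fun j => p (S j)) (fun j => q (S j)) C.
Proof.
  intros h. split; intros j; try apply h.
  generalize (sp_growth _ _ _ h (S j)) (pos_INR j). rewrite S_INR. nra.
Qed.

(** The weight of the first pair is the total mass of the blocks that follow, by
    [block_mass_sum]. *)
Definition balanced_weight (s : R) (p : nat -> R) (j : nat) : R :=
  match j with
  | O => Rpower (p 1%nat) (- s) / s
  | S i => - block_mass s p (S i)
  end.

Lemma is_lim_Rpower_neg (s : R) :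
  0 < s -> is_lim (fun y => Rpower y (- s)) p_infty 0.
Proof.
  intros hs. apply is_lim_ext_loc with (fun y => exp (- s * ln y)).
  { exists 0. reflexivity. }
  apply (is_lim_comp exp (fun y => - s * ln y) p_infty 0 m_infty).
  - apply is_lim_exp_m.
  - replace m_infty with (Rbar_mult (- s) p_infty).
    + apply is_lim_scal_l. apply is_lim_ln_p.
    + simpl. destruct (Rle_dec 0 (- s)); [exfalso; lra | reflexivity].
  - exists 0. discriminate.
Qed.

Lemma block_mass_sum s p q C :
  spectral_pairs p q C -> 0 < s ->
  is_series (block_mass s p) (Rpower (p O) (- s) / s).
Proof.
  intros h hs.
  apply is_series_ext with
    (fun j => - / s * Rpower (p (S j)) (- s) - (- / s * Rpower (p j) (- s))).
  { intros j. unfold block_mass. simpl. field. lra. }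
  replace (Rpower (p O) (- s) / s)
    with (- / s * 0 - (- / s * Rpower (p O) (- s))) by (field; lra).
  apply (is_series_telescope (fun j => - / s * Rpower (p j) (- s))).
  apply (is_lim_seq_scal_l (fun j => Rpower (p j) (- s)) (- / s) 0).
  apply (is_lim_comp_seq _ p p_infty 0 (is_lim_Rpower_neg s hs)).
  - now exists O.
  - exact (sp_infty _ _ _ h).
Qed.

(** By the balance, only the differences [/ w ^ 2 - m j] of the means with their
    limit at low levels matter; they are integrated by [M], with exponent
    [2 - s]. The errors need a primitive of their own, [M3], whose exponent
    [3 / 2 - s] keeps the integral convergent at both ends. *)
Lemma rate_positive s p q C :
  spectral_pairs p q C -> 0 < s <= 1 ->
  realizes_rate s p q (balanced_weight s p).
Proof.
  intros h hs.
  assert (h' := spectral_pairs_shift p q C h).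
  set (p' := fun j => p (S j)) in *. set (q' := fun j => q (S j)) in *.
  assert (hB : forall j, 0 < block_mass s p (S j)).
  { intros j. apply (block_mass_gt0 s p q C); [exact h | lra]. }
  assert (hC := sp_gap_constant_ge0 p q C h).
  assert (h4 := sp_ge4 _ _ _ O h). assert (ho := sp_order _ _ _ h O).
  set (T := Rpower (p 1%nat) (- s) / s).
  assert (hT : 0 < T) by (apply Rdiv_lt_0_compat; [apply Rpower_gt0 | lra]).
  assert (hTs : is_series (block_mass s p') T).
  { apply (block_mass_sum s p' q' C h'). lra. }
  set (D := C + T / Rpower (p O) (- s - 1 / 2)).
  assert (hT' : 0 < T / Rpower (p O) (- s - 1 / 2)).
  { apply Rdiv_lt_0_compat; [exact hT | apply Rpower_gt0]. }
  assert (hD : forall j,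
    Rabs (balanced_weight s p j) <= D * Rpower (p j) (- s - 1 / 2)).
  { intros [|j]; simpl; fold T.
    - rewrite Rabs_right by lra.
      apply Rle_trans with (T / Rpower (p O) (- s - 1 / 2) * Rpower (p O) (- s - 1 / 2)).
      + right. field. generalize (Rpower_gt0 (p O) (- s - 1 / 2)). lra.
      + apply Rmult_le_compat_r; [left; apply Rpower_gt0 | unfold D; lra].
    - rewrite Rabs_Ropp, Rabs_right by (left; apply hB).
      apply Rle_trans with (C * Rpower (p (S j)) (- s - 1 / 2)).
      + apply (block_mass_le s p q); [exact h | lra | lra].
      + apply Rmult_le_compat_r; [left; apply Rpower_gt0 | unfold D; lra]. }
  assert (hex := fun w => ex_series_mean s p q C D (balanced_weight s p) w h
                  ltac:(lra) ltac:(unfold D; lra) hD).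
  (* The balance makes the response insensitive to a shift of the means: [r] is
     [m 0] for the sign and [/ w ^ 2] for the asymptotics. *)
  assert (hresp : forall w r,
    is_series (fun j => block_mass s p' j * (r - pair_mean w (p' j) (q' j)))
      (response p q (balanced_weight s p) w - T * (pair_mean w (p O) (q O) - r))).
  { intros w r.
    assert (h1 := is_series_incr_1 (V := R_NormedModule)
      (fun j => balanced_weight s p j * pair_mean w (p j) (q j))
      (response p q (balanced_weight s p) w - T * pair_mean w (p O) (q O))).
    assert (h2 := is_series_scal (K := R_AbsRing) (V := R_NormedModule) r _ _ hTs).
    evar_last.
    - apply is_series_ext with (fun j => r * block_mass s p' j +
        balanced_weight s p (S j) * pair_mean w (p' j) (q' j)).
      + intros j. simpl. unfold block_mass, p'. simpl. ring.
      + apply (is_series_plus (V := R_NormedModule)); [exact h2|].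
        apply h1. evar_last; [apply Series_correct, hex|].
        unfold plus; simpl. fold T.
        unfold response. ring.
    - unfold plus, scal; simpl. unfold mult; simpl. ring. }
  split; [|split].
  - exists D. split; [unfold D; lra | exact hD].
  - intros w. assert (hr := hresp w (pair_mean w (p O) (q O))).
    rewrite Rminus_diag, Rmult_0_r, Rminus_0_r in hr.
    rewrite <- (is_series_unique _ _ hr). apply Series_gt0.
    + intros j. apply Rmult_lt_0_compat; [apply hB|].
      assert (o : q O < p' j).
      { apply Rlt_le_trans with (p 1%nat); [lra|]. unfold p'.
        induction j as [|j IH]; [lra|]. generalize (sp_order _ _ _ h (S j)). lra. }
      assert (o2 := sp_order _ _ _ h' j). fold p' q' in o2. cbv beta in o2.
      generalize (pair_mean_bounds w (p O) (q O) ltac:(lra))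
        (pair_mean_bounds w (p' j) (q' j) ltac:(lra))
        (resolvent_decr_strict w (q O) (p' j) ltac:(lra)). lra.
    + now eexists; apply hr.
  - destruct (scaled_primitive (2 - s)) as [alpha [ha HM]]; [lra|].
    destruct (scaled_primitive (3 / 2 - s)) as [A3 [hA3 HM3]]; [lra|].
    exists alpha, (1 / 2),
      (6 * C * A3 + Rpower (p 1%nat) (2 - s) / (2 - s) + T * q O ^ 2).
    split; [exact ha | split; [lra|]].
    intros w hw. destruct (HM w ltac:(lra)) as [M [hM [hM0 hMl]]].
    destruct (HM3 w ltac:(lra)) as [M3 [hM3 [hM30 hM3l]]].
    set (L := alpha * Rpower w (2 - s - 2)) in *.
    set (L3 := A3 * Rpower w (3 / 2 - s - 2)) in *.
    assert (hw2 : 0 < / w ^ 2) by (apply Rinv_0_lt_compat; nra).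
    assert (hser : forall N l, is_lim N p_infty (Finite l) ->
      is_series (fun j => N (p' (S j)) - N (p' j)) (l - N (p 1%nat))).
    { intros N l hN. apply (is_series_telescope (fun j => N (p' j)) l).
      apply (is_lim_comp_seq N p' p_infty l hN); [now exists O|].
      exact (sp_infty _ _ _ h'). }
    destruct (Series_near
      (fun j => block_mass s p' j * (/ w ^ 2 - pair_mean w (p' j) (q' j)))
      (fun j => / w ^ 2 * (M (p' (S j)) - M (p' j)))
      (fun j => 6 * C * / w ^ 2 * (M3 (p' (S j)) - M3 (p' j)))
      (/ w ^ 2 * (L - M (p 1%nat))) (6 * C * / w ^ 2 * (L3 - M3 (p 1%nat))))
      as [_ hn].
    + intros j.
      assert (h4j := sp_ge4 _ _ _ j h'). assert (hoj := sp_order _ _ _ h' j).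
      cbv beta in h4j, hoj.
      assert (hd : forall y, 0 < y ->
        is_derive (fun y => - / w ^ 2 * M y) y
          (Rpower y (- s - 1) * (- / w ^ 2 + resolvent w y))).
      { intros y hy. evar_last.
        - apply @is_derive_scal. now apply hM.
        - replace (2 - s - 1) with (- s - 1 + INR 2) by (simpl; ring).
          rewrite Rpower_plus, Rpower_pow by lra.
          unfold resolvent. simpl. field. split; nra. }
      assert (hc := mass_mean_close s w p' q' C j _ (- / w ^ 2) h' ltac:(lra) hd).
      cbv beta in hc.
      rewrite <- Rabs_Ropp.
      replace (- (block_mass s p' j * (/ w ^ 2 - pair_mean w (p' j) (q' j)) -
                  / w ^ 2 * (M (p' (S j)) - M (p' j))))
        with (block_mass s p' j * (- / w ^ 2 + pair_mean w (p' j) (q' j)) -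
              (- / w ^ 2 * M (p' (S j)) - - / w ^ 2 * M (p' j))) by ring.
      apply Rle_trans with (1 := hc).
      rewrite (Rmult_assoc (6 * C) (/ w ^ 2)).
      apply Rmult_le_compat_l; [lra|].
      destruct (block_mass_sandwich s p' q' C j M3
        (fun y => Rpower y (3 / 2) * resolvent w y)
        (Rpower (p' j) (3 / 2) * resolvent w (p' (S j)))
        (Rpower (p' (S j)) (3 / 2) * resolvent w (p' j)) h' ltac:(lra)) as [h1 _].
      * intros y hy. evar_last; [apply hM3; unfold p' in *; lra|].
        replace (3 / 2 - s - 1) with (- s - 1 + 3 / 2) by ring.
        rewrite Rpower_plus. unfold resolvent, Rdiv. ring.
      * intros y hy.
        split; apply Rmult_le_compat;
          first [ left; apply Rpower_gt0
                | apply Rle_Rpower_l; unfold p' in *; lra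
                | apply resolvent_decr; unfold p' in *; lra
                | left; apply resolvent_gt0; unfold p' in *; lra ].
      * apply Rle_trans with
          (/ w ^ 2 * (Rpower (p' j) (3 / 2) * resolvent w (p' (S j)) *
                      block_mass s p' j)).
        -- replace (block_mass s p' j * (Rpower (p' j) (3 / 2) *
              resolvent w (p' j) * resolvent w (p' (S j)))) with
             (resolvent w (p' j) * (Rpower (p' j) (3 / 2) *
                resolvent w (p' (S j)) * block_mass s p' j)) by ring.
           apply Rmult_le_compat_r.
           { apply Rmult_le_pos; [|left; apply hB].
             apply Rmult_le_pos; left;
             [apply Rpower_gt0 | apply resolvent_gt0; unfold p' in *; lra]. }
           apply Rinv_le_contravar; nra.
        -- apply Rmult_le_compat_l; [lra | exact h1].
    + apply (is_series_scal (K := R_AbsRing) (V := R_NormedModule)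
        (/ w ^ 2) _ _ (hser M L hMl)).
    + apply (is_series_scal (K := R_AbsRing) (V := R_NormedModule)
        (6 * C * / w ^ 2) _ _ (hser M3 L3 hM3l)).
    + rewrite (is_series_unique _ _ (hresp w (/ w ^ 2))) in hn.
      set (r := response p q (balanced_weight s p) w) in *.
      destruct (hM0 (p 1%nat) ltac:(lra)) as [m1 m2].
      destruct (hM30 (p 1%nat) ltac:(lra)) as [m3 _].
      destruct (pair_mean_defect w (p O) (q O) ltac:(lra) ltac:(lra)) as [d1 d2].
      set (m := pair_mean w (p O) (q O)) in *.
      assert (eL : alpha * Rpower w (- (2 + s)) = / w ^ 2 * L).
      { unfold L. rewrite (Rpower_neg_nat w 2) by lra.
        rewrite <- Rmult_assoc, (Rmult_comm (Rpower w _) alpha), Rmult_assoc.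
        rewrite <- Rpower_plus. do 2 f_equal. simpl. ring. }
      rewrite eL.
      assert (e3 : / w ^ 2 * L3 = A3 * Rpower w (- (2 + s + 1 / 2))).
      { unfold L3. rewrite (Rpower_neg_nat w 2) by lra.
        rewrite <- Rmult_assoc, (Rmult_comm (Rpower w _) A3), Rmult_assoc.
        rewrite <- Rpower_plus. do 2 f_equal. simpl. field. }
      assert (e4 : / w ^ 4 <= Rpower w (- (2 + s + 1 / 2))).
      { rewrite Rpower_neg_nat by lra. apply Rle_Rpower; [lra|]. simpl. lra. }
      assert (b1 : / w ^ 2 * M (p 1%nat) <=
        Rpower (p 1%nat) (2 - s) / (2 - s) * Rpower w (- (2 + s + 1 / 2))).
      { apply Rle_trans with
          (/ w ^ 2 * (Rpower (p 1%nat) (2 - s) / (2 - s) / w ^ 2)).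
        - apply Rmult_le_compat_l; lra.
        - replace (/ w ^ 2 * (Rpower (p 1%nat) (2 - s) / (2 - s) / w ^ 2)) with
            (Rpower (p 1%nat) (2 - s) / (2 - s) * / w ^ 4) by (field; lra).
          apply Rmult_le_compat_l; [|exact e4].
          left. apply Rdiv_lt_0_compat; [apply Rpower_gt0 | lra]. }
      assert (b2 : T * (/ w ^ 2 - m) <= T * q O ^ 2 * Rpower w (- (2 + s + 1 / 2))).
      { rewrite Rmult_assoc. apply Rmult_le_compat_l; [lra|].
        apply Rle_trans with (1 := d2). apply Rmult_le_compat_l; [nra|exact e4]. }
      assert (b3 : 0 <= 6 * C * / w ^ 2 * M3 (p 1%nat)).
      { apply Rmult_le_pos; [|exact m3]. apply Rmult_le_pos; lra. }
      assert (b4 : 0 <= / w ^ 2 * M (p 1%nat)) by (apply Rmult_le_pos; lra).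
      assert (b5 : 0 <= T * (/ w ^ 2 - m)) by (apply Rmult_le_pos; lra).
      rewrite (Rmult_minus_distr_l _ L3), (Rmult_assoc (6 * C) _ L3), e3 in hn.
      rewrite !Rmult_plus_distr_r, (Rmult_assoc (6 * C) A3).
      apply Rabs_le_between in hn. apply Rabs_le. lra.
Qed.

Lemma weights_exist s p q C :
  spectral_pairs p q C -> -1 <= s <= 1 ->
  exists A, realizes_rate s p q A /\ (s = 0 -> forall j, A (S j) = 0).
Proof.
  intros h hs. destruct (Rtotal_order s 0) as [h0|[h0|h0]].
  - exists (block_mass s p). split; [apply (rate_negative s p q C h); lra | lra].
  - subst s. exists (head_weight 1).
    split; [exact (rate_zero p q C h) | reflexivity].
  - exists (balanced_weight s p).
    split; [apply (rate_positive s p q C h); lra | lra].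
Qed.

(** * Sine series carried by separated pairs *)

(** [lambda2 n k] at [n = k * (3 * j + 3)], by [lambda2_multiple]; [high_level] is
    its value at [n + k]. *)
Definition low_level (k j : nat) : R := (INR k * PI) ^ 2 * (INR (3 * j + 3) ^ 2 - / 2).
Definition high_level (k j : nat) : R := (INR k * PI) ^ 2 * (INR (3 * j + 4) ^ 2 - / 2).

Lemma lambda2_multiple k m :
  lambda2 (k * m) k = (INR k * PI) ^ 2 * (INR m ^ 2 - / 2).
Proof. unfold lambda2, lambda. rewrite mult_INR. field. Qed.

Lemma INR_3j3 (j : nat) : INR (3 * j + 3) = 3 * INR j + 3.
Proof. rewrite plus_INR, mult_INR. simpl. ring. Qed.

Lemma INR_3j4 (j : nat) : INR (3 * j + 4) = 3 * INR j + 4.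
Proof. rewrite plus_INR, mult_INR. simpl. ring. Qed.

Lemma PI_gt3 : 3 < PI.
Proof. generalize PI2_3_2. lra. Qed.

Lemma fundamental_ge3 k : (1 <= k)%nat -> 3 <= INR k * PI.
Proof.
  intros hk. apply le_INR in hk. simpl in hk. generalize PI_gt3. nra.
Qed.

Lemma levels_spectral_pairs k :
  (1 <= k)%nat ->
  spectral_pairs (low_level k) (high_level k) (14 * (INR k * PI)).
Proof.
  intros hk. assert (hr := fundamental_ge3 k hk).
  unfold low_level, high_level. set (r := INR k * PI) in *.
  assert (r2 : 9 <= r ^ 2) by nra.
  split; intros j; assert (hj := pos_INR j); rewrite ?INR_3j3, ?INR_3j4, ?S_INR.
  - apply Rle_trans with (9 * ((3 * INR j + 3) ^ 2 - / 2)); [nra|].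
    apply Rmult_le_compat_r; nra.
  - split; apply Rmult_lt_compat_l; nra.
  - rewrite <- Rmult_assoc, (Rmult_comm 5), Rmult_assoc.
    apply Rmult_le_compat_l; nra.
  - (* The gap is [r ^ 2 * (18 * j + 27)], and [r * (2 * j + 2)] is a lower bound
       of the square root of the level. *)
    apply Rle_trans with (14 * r * (r * (2 * INR j + 2))).
    + replace (14 * r * (r * (2 * INR j + 2))) with (r ^ 2 * (28 * INR j + 28)) by ring.
      rewrite <- Rmult_minus_distr_l. apply Rmult_le_compat_l; nra.
    + apply Rmult_le_compat_l; [nra|].
      rewrite <- (sqrt_Rsqr (r * (2 * INR j + 2))) by nra.
      apply sqrt_le_1_alt. unfold Rsqr.
      replace (r * (2 * INR j + 2) * (r * (2 * INR j + 2)))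
        with (r ^ 2 * (2 * INR j + 2) ^ 2) by ring.
      apply Rmult_le_compat_l; nra.
Qed.

Definition signed_sqrt (x : R) : R := sign x * sqrt (Rabs x).

Lemma sqrt_signed_sqrt x : sqrt (Rabs x) * signed_sqrt x = x.
Proof.
  unfold signed_sqrt. rewrite Rmult_comm, Rmult_assoc, sqrt_sqrt by apply Rabs_pos.
  unfold sign. destruct (total_order_T 0 x) as [[h|h]|h].
  - rewrite Rabs_right; lra.
  - subst x. ring.
  - rewrite Rabs_left; lra.
Qed.

Lemma signed_sqrt_sq x : signed_sqrt x ^ 2 = Rabs x.
Proof.
  unfold signed_sqrt.
  replace ((sign x * sqrt (Rabs x)) ^ 2)
    with (sign x * sign x * (sqrt (Rabs x) * sqrt (Rabs x))) by ring.
  rewrite sqrt_sqrt by apply Rabs_pos.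
  unfold sign. destruct (total_order_T 0 x) as [[h|h]|h].
  - ring.
  - subst x. rewrite Rabs_R0. ring.
  - ring.
Qed.

(** The coefficient [mu n / n] at [n = k * m]: the two members [3 * j + 3] and
    [3 * j + 4] of a pair share the size [sqrt (Rabs (a j))], their product is
    [a j], and the residue [2] modulo [3] separates the pairs. *)
Definition pair_profile (a : nat -> R) (m : nat) : R :=
  match (m / 3)%nat with
  | O => 0
  | S j => match (m mod 3)%nat with
           | O => sqrt (Rabs (a j))
           | 1%nat => signed_sqrt (a j)
           | _ => 0
           end
  end.

Definition paired_series (k : nat) (a : nat -> R) (n : nat) : R :=
  if Nat.eqb (n mod k) 0 then INR n * pair_profile a (n / k) else 0.

Lemma div_mod_3 j r : (r < 3)%nat ->
  ((3 * j + r) / 3)%nat = j /\ ((3 * j + r) mod 3)%nat = r.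
Proof.
  intros hr. split.
  - symmetry. apply (Nat.div_unique _ 3 j r); lia.
  - symmetry. apply (Nat.mod_unique _ 3 j r); lia.
Qed.

Lemma pair_profile_low a j : pair_profile a (3 * j + 3) = sqrt (Rabs (a j)).
Proof.
  unfold pair_profile. replace (3 * j + 3)%nat with (3 * S j + 0)%nat by lia.
  destruct (div_mod_3 (S j) 0) as [-> ->]; [lia|]. reflexivity.
Qed.

Lemma pair_profile_high a j : pair_profile a (3 * j + 4) = signed_sqrt (a j).
Proof.
  unfold pair_profile. replace (3 * j + 4)%nat with (3 * S j + 1)%nat by lia.
  destruct (div_mod_3 (S j) 1) as [-> ->]; [lia|]. reflexivity.
Qed.

Lemma pair_profile_gap a j : pair_profile a (3 * j + 2) = 0.
Proof.
  unfold pair_profile.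
  destruct (div_mod_3 j 2) as [-> ->]; [lia|]. now destruct j.
Qed.

Lemma paired_series_multiple k a m :
  (1 <= k)%nat -> paired_series k a (k * m) = INR (k * m) * pair_profile a m.
Proof.
  intros hk. unfold paired_series.
  replace ((k * m) mod k)%nat with O.
  - simpl Nat.eqb. cbv iota. rewrite (Nat.mul_comm k m), Nat.div_mul by lia. reflexivity.
  - rewrite Nat.mul_comm. symmetry. apply Nat.Div0.mod_mul.
Qed.

Lemma paired_series_coef k a m :
  (1 <= k)%nat -> (1 <= m)%nat ->
  paired_series k a (k * m) / INR (k * m) = pair_profile a m.
Proof.
  intros hk hm. rewrite paired_series_multiple by exact hk.
  field. apply not_0_INR. nia.
Qed.

Lemma paired_series_cases k a n :
  (1 <= k)%nat ->
  paired_series k a n = 0 \/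
  exists j, n = (k * (3 * j + 3))%nat \/ n = (k * (3 * j + 4))%nat.
Proof.
  intros hk. unfold paired_series.
  destruct (Nat.eqb_spec (n mod k) 0) as [e|]; [|now left].
  assert (en : n = (k * (n / k))%nat).
  { generalize (Nat.div_mod_eq n k). lia. }
  set (m := (n / k)%nat) in *.
  assert (em := Nat.div_mod_eq m 3).
  unfold pair_profile. destruct (m / 3)%nat as [|j]; [left; ring|].
  destruct (m mod 3)%nat as [|[|r]].
  - right. exists j. left. rewrite en, em. f_equal. lia.
  - right. exists j. right. rewrite en, em. f_equal. lia.
  - left. ring.
Qed.

Lemma K_term_outside mu k w n : mu n = 0 -> K_term mu k w n = 0.
Proof. intros h. unfold K_term. rewrite h. unfold Rdiv. ring. Qed.

(** The neighbour [n + k] is the other member of the pair, and [n - k] falls in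
    the gap between two pairs. *)
Lemma K_term_low k a w j :
  (1 <= k)%nat ->
  K_term (paired_series k a) k w (k * (3 * j + 3)) =
  a j * (low_level k j / (low_level k j ^ 2 + w ^ 2)).
Proof.
  intros hk. unfold K_term. rewrite lambda2_multiple.
  rewrite paired_series_coef by lia.
  replace (k * (3 * j + 3) + k)%nat with (k * (3 * j + 4))%nat by ring.
  rewrite paired_series_coef by lia.
  destruct (Nat.eqb_spec (k * (3 * j + 3)) k) as [e|_]; [nia|].
  replace (absdiff (k * (3 * j + 3)) k) with (k * (3 * j + 2))%nat
    by (unfold absdiff; nia).
  rewrite paired_series_coef by lia.
  rewrite pair_profile_low, pair_profile_high, pair_profile_gap, Rplus_0_r.
  now rewrite sqrt_signed_sqrt.
Qed.

Lemma K_term_high k a w j :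
  (1 <= k)%nat ->
  K_term (paired_series k a) k w (k * (3 * j + 4)) =
  a j * (high_level k j / (high_level k j ^ 2 + w ^ 2)).
Proof.
  intros hk. unfold K_term. rewrite lambda2_multiple.
  rewrite paired_series_coef by lia.
  replace (k * (3 * j + 4) + k)%nat with (k * (3 * S j + 2))%nat by ring.
  rewrite paired_series_coef by lia.
  destruct (Nat.eqb_spec (k * (3 * j + 4)) k) as [e|_]; [nia|].
  replace (absdiff (k * (3 * j + 4)) k) with (k * (3 * j + 3))%nat
    by (unfold absdiff; nia).
  rewrite paired_series_coef by lia.
  rewrite pair_profile_low, pair_profile_high, pair_profile_gap, Rplus_0_l.
  now rewrite (Rmult_comm (signed_sqrt _)), sqrt_signed_sqrt.
Qed.

(** The terms are split according to the member of the pair, [t1] for the lower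
    and [t2] for the upper one; each part is a subseries. *)
Lemma K_paired_series k a w :
  (1 <= k)%nat ->
  ex_series (fun j => a j * (low_level k j / (low_level k j ^ 2 + w ^ 2))) ->
  ex_series (fun j => a j * (high_level k j / (high_level k j ^ 2 + w ^ 2))) ->
  K (paired_series k a) k w =
  Series (fun j => a j * (low_level k j / (low_level k j ^ 2 + w ^ 2) +
                          high_level k j / (high_level k j ^ 2 + w ^ 2))).
Proof.
  intros hk hl hh.
  set (t := fun i => K_term (paired_series k a) k w (S i)).
  set (t1 := fun i => if Nat.eqb ((S i / k) mod 3) 0 then t i else 0).
  set (t2 := fun i => if Nat.eqb ((S i / k) mod 3) 0 then 0 else t i).
  assert (lowE : forall j, ((k * (3 * j + 3) / k) mod 3 = 0)%nat).
  { intros j. rewrite Nat.mul_comm, Nat.div_mul by lia.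
    replace (3 * j + 3)%nat with (3 * S j + 0)%nat by lia. apply div_mod_3. lia. }
  assert (highE : forall j, ((k * (3 * j + 4) / k) mod 3 = 1)%nat).
  { intros j. rewrite Nat.mul_comm, Nat.div_mul by lia.
    replace (3 * j + 4)%nat with (3 * S j + 1)%nat by lia. apply div_mod_3. lia. }
  assert (s1 : is_series t1 (Series
    (fun j => a j * (low_level k j / (low_level k j ^ 2 + w ^ 2))))).
  { apply (is_series_sparse t1 (fun j => k * (3 * j + 3) - 1)%nat).
    - intros j. nia.
    - intros i hi. unfold t1.
      destruct (Nat.eqb_spec ((S i / k) mod 3) 0) as [e|]; [|reflexivity].
      apply K_term_outside.
      destruct (paired_series_cases k a (S i) hk) as [z|[j [e'|e']]];
        [exact z | |].
      + exfalso. apply (hi j). lia.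
      + rewrite e', highE in e. discriminate.
    - apply is_series_ext with (2 := Series_correct _ hl). intros j.
      unfold t1, t. replace (S (k * (3 * j + 3) - 1)) with (k * (3 * j + 3))%nat by nia.
      rewrite lowE. simpl Nat.eqb. cbv iota. now rewrite K_term_low. }
  assert (s2 : is_series t2 (Series
    (fun j => a j * (high_level k j / (high_level k j ^ 2 + w ^ 2))))).
  { apply (is_series_sparse t2 (fun j => k * (3 * j + 4) - 1)%nat).
    - intros j. nia.
    - intros i hi. unfold t2.
      destruct (Nat.eqb_spec ((S i / k) mod 3) 0) as [|e]; [reflexivity|].
      apply K_term_outside.
      destruct (paired_series_cases k a (S i) hk) as [z|[j [e'|e']]];
        [exact z | |].
      + exfalso. apply e. now rewrite e', lowE.
      + exfalso. apply (hi j). lia.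
    - apply is_series_ext with (2 := Series_correct _ hh). intros j.
      unfold t2, t. replace (S (k * (3 * j + 4) - 1)) with (k * (3 * j + 4))%nat by nia.
      rewrite highE. simpl Nat.eqb. cbv iota. now rewrite K_term_high. }
  rewrite (Series_ext _ (fun j => a j * (low_level k j / (low_level k j ^ 2 + w ^ 2)) +
    a j * (high_level k j / (high_level k j ^ 2 + w ^ 2))))
    by (intros; ring).
  rewrite (Series_plus _ _ hl hh).
  change (Series t = Series
    (fun j => a j * (low_level k j / (low_level k j ^ 2 + w ^ 2))) + Series
    (fun j => a j * (high_level k j / (high_level k j ^ 2 + w ^ 2)))).
  apply is_series_unique.
  apply is_series_ext with (fun i => t1 i + t2 i).
  - intros i. unfold t1, t2. destruct (Nat.eqb ((S i / k) mod 3) 0).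
    + apply Rplus_0_r.
    + apply Rplus_0_l.
  - apply (is_series_plus (V := R_NormedModule) _ _ _ _ s1 s2).
Qed.

Definition pair_weight (eps : R) (A : nat -> R) (k j : nat) : R :=
  eps * A j / (low_level k j + high_level k j).

Lemma pair_weight_bound s eps A k D j :
  (1 <= k)%nat -> Rabs eps = 1 -> 0 <= D ->
  Rabs (A j) <= D * Rpower (low_level k j) (- s - 1 / 2) ->
  Rabs (pair_weight eps A k j) <= D * Rpower (low_level k j) (- s - 3 / 2).
Proof.
  intros hk he hD hA. assert (h := levels_spectral_pairs k hk).
  assert (h4 := sp_ge4 _ _ _ j h). assert (ho := sp_order _ _ _ h j).
  replace (- s - 3 / 2) with (- s - 1 / 2 + - (1)) by field.
  rewrite Rpower_plus, Rpower_Ropp, Rpower_1, <- Rmult_assoc by lra.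
  unfold pair_weight. unfold Rdiv at 1. rewrite 2!Rabs_mult, he, Rmult_1_l.
  rewrite (Rabs_right (/ _)) by (left; apply Rinv_0_lt_compat; lra).
  apply Rmult_le_compat; [apply Rabs_pos | | exact hA |].
  - left; apply Rinv_0_lt_compat; lra.
  - apply Rinv_le_contravar; lra.
Qed.

Lemma K_pair_weight s eps A k w :
  (1 <= k)%nat -> Rabs eps = 1 -> -1 <= s ->
  (exists D, 0 <= D /\
     forall j, Rabs (A j) <= D * Rpower (low_level k j) (- s - 1 / 2)) ->
  K (paired_series k (pair_weight eps A k)) k w =
  eps * response (low_level k) (high_level k) A w.
Proof.
  intros hk he hs [D [hD hA]]. assert (h := levels_spectral_pairs k hk).
  assert (hex : forall y : nat -> R, (forall j, low_level k j <= y j) ->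
    ex_series (fun j => pair_weight eps A k j * (y j / (y j ^ 2 + w ^ 2)))).
  { intros y hy. apply (ex_series_of_bound _ _ _ D _ h). intros j.
    assert (h4 := sp_ge4 _ _ _ j h). specialize (hy j).
    rewrite Rabs_mult. unfold Rdiv at 2.
    rewrite <- (Rmult_1_r D) at 1. unfold Rdiv. rewrite Rmult_assoc, Rmult_1_l.
    apply Rmult_le_compat; try apply Rabs_pos.
    - apply Rle_trans with (1 := pair_weight_bound s eps A k D j hk he hD (hA j)).
      rewrite <- (Rmult_1_r D) at 2. apply Rmult_le_compat_l; [exact hD|].
      rewrite <- (Rpower_O (low_level k j)) by lra. apply Rle_Rpower; lra.
    - rewrite Rabs_right.
      + apply Rle_trans with (/ y j); [|apply Rinv_le_contravar; lra].
        apply Rle_div_l; [nra|].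
        apply Rmult_le_reg_l with (y j); [lra|].
        rewrite <- Rmult_assoc, Rinv_r by lra. nra.
      + apply Rle_ge, Rdiv_le_0_compat; nra. }
  rewrite K_paired_series.
  - unfold response. rewrite <- Series_scal_l. apply Series_ext. intros j.
    assert (h4 := sp_ge4 _ _ _ j h). assert (ho := sp_order _ _ _ h j).
    unfold pair_weight, pair_mean. field. repeat split; nra.
  - exact hk.
  - apply (hex (low_level k)). intros; lra.
  - apply (hex (high_level k)). intros j. generalize (sp_order _ _ _ h j). lra.
Qed.

(** * Regularity, two-mode series and Japanese brackets *)

Lemma sin_INR_PI n : sin (INR n * PI) = 0.
Proof. apply sin_eq_0_1. exists (Z.of_nat n). now rewrite <- INR_IZR_INZ. Qed.

Lemma scal_phi_diff n m :
  (1 <= n)%nat -> (1 <= m)%nat -> n <> m ->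
  is_RInt (fun x => phi n x * phi m x) 0 1 0.
Proof.
  intros hn hm hnm.
  assert (PI0 := PI_RGT_0).
  apply le_INR in hn. apply le_INR in hm. simpl in hn, hm.
  assert (hne : INR n - INR m <> 0).
  { intros e. apply hnm, INR_eq. lra. }
  set (F := fun x => sin (INR n * PI * x - INR m * PI * x) / ((INR n - INR m) * PI)
    - sin (INR n * PI * x + INR m * PI * x) / ((INR n + INR m) * PI)).
  evar_last.
  - apply (is_RInt_derive F (fun x => phi n x * phi m x)).
    + intros x _. unfold F. evar_last.
      * auto_derive; [exact I | reflexivity].
      * unfold phi.
        replace (sqrt 2 * sin (INR n * PI * x) * (sqrt 2 * sin (INR m * PI * x)))
          with (sqrt 2 * sqrt 2 * (sin (INR n * PI * x) * sin (INR m * PI * x))) by ring.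
        rewrite sqrt_sqrt by lra.
        unfold Rminus. rewrite !cos_plus, cos_neg, sin_neg.
        field. repeat split; lra.
    + intros x _. apply (ex_derive_continuous (V := R_NormedModule)).
      unfold phi. auto_derive. exact I.
  - unfold F, minus, plus, opp; simpl.
    rewrite !Rmult_1_r, !Rmult_0_r, Rminus_0_r, Rplus_0_r, sin_0.
    rewrite sin_minus, sin_plus, !sin_INR_PI. field. repeat split; lra.
Qed.

Lemma scal_phi_same n :
  (1 <= n)%nat -> is_RInt (fun x => phi n x * phi n x) 0 1 1.
Proof.
  intros hn. assert (PI0 := PI_RGT_0). apply le_INR in hn. simpl in hn.
  set (F := fun x => x - sin (INR n * PI * x + INR n * PI * x) / (2 * INR n * PI)).
  evar_last.
  - apply (is_RInt_derive F (fun x => phi n x * phi n x)).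
    + intros x _. unfold F. evar_last.
      * auto_derive; [exact I | reflexivity].
      * unfold phi.
        replace (sqrt 2 * sin (INR n * PI * x) * (sqrt 2 * sin (INR n * PI * x)))
          with (sqrt 2 * sqrt 2 * (sin (INR n * PI * x) * sin (INR n * PI * x))) by ring.
        rewrite sqrt_sqrt by lra.
        rewrite cos_plus.
        assert (e := sin2_cos2 (INR n * PI * x)). unfold Rsqr in e.
        replace (cos (INR n * PI * x) * cos (INR n * PI * x))
          with (1 - sin (INR n * PI * x) * sin (INR n * PI * x)) by lra.
        field. repeat split; lra.
    + intros x _. apply (ex_derive_continuous (V := R_NormedModule)).
      unfold phi. auto_derive. exact I.
  - unfold F, minus, plus, opp; simpl.
    rewrite !Rmult_1_r, !Rmult_0_r, Rplus_0_r, sin_0.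
    rewrite sin_plus, !sin_INR_PI. field. repeat split; lra.
Qed.

Lemma two_mode_of_support (mu : nat -> R) n m :
  (1 <= n)%nat -> (1 <= m)%nat -> n <> m ->
  (forall i, i <> n -> i <> m -> mu i = 0) -> two_mode_combination mu.
Proof.
  intros hn hm hnm h. exists n, m, (mu n), (mu m).
  split; [exact hn | split; [exact hm | split; [exact hnm|]]].
  intros i hi. unfold scal_L2. symmetry. apply is_RInt_unique.
  assert (hsum : forall u v, is_RInt (fun x => phi n x * phi i x) 0 1 u ->
    is_RInt (fun x => phi m x * phi i x) 0 1 v ->
    is_RInt (fun x => (mu n * phi n x + mu m * phi m x) * phi i x) 0 1
      (mu n * u + mu m * v)).
  { intros u v hu hv.
    apply is_RInt_ext with
      (fun x => mu n * (phi n x * phi i x) + mu m * (phi m x * phi i x)).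
    - intros x _. simpl. ring.
    - apply (is_RInt_plus (V := R_NormedModule)).
      + now apply (is_RInt_scal (V := R_NormedModule)).
      + now apply (is_RInt_scal (V := R_NormedModule)). }
  destruct (Nat.eq_dec i n) as [->|hin]; [|destruct (Nat.eq_dec i m) as [->|him]].
  - evar_last.
    + apply hsum; [now apply scal_phi_same | apply scal_phi_diff; auto].
    + simpl. ring.
  - evar_last.
    + apply hsum; [now apply scal_phi_diff | now apply scal_phi_same].
    + simpl. ring.
  - rewrite (h i hin him). evar_last.
    + apply hsum; apply scal_phi_diff; auto.
    + simpl. ring.
Qed.

Lemma in_Hinf_of_bound r mu B :
  (forall n, (1 <= n)%nat -> Rabs (Rpower (lambda n) (r / 2) * mu n) <= B) ->
  in_Hinf r mu.
Proof.
  intros h. unfold in_Hinf, Hinf_norm.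
  apply Rbar_le_lt_trans with (Sup_seq (fun _ => Finite B)).
  - apply Sup_seq_le. intros i. apply h. lia.
  - rewrite (is_sup_seq_unique (fun _ => Finite B) (Finite B)); [exact I|].
    intros e. split; [intros _ | exists O]; simpl; generalize (cond_pos e); lra.
Qed.

(** Because [lambda n >= 1]. *)
Lemma in_Hinf_le r r' mu : r <= r' -> in_Hinf r' mu -> in_Hinf r mu.
Proof.
  intros hr h. unfold in_Hinf, Hinf_norm in *.
  eapply Rbar_le_lt_trans; [|exact h].
  apply Sup_seq_le. intros i. simpl. rewrite !Rabs_mult.
  apply Rmult_le_compat_r; [apply Rabs_pos|].
  rewrite !Rabs_right by (left; apply Rpower_gt0).
  apply Rle_Rpower; [|lra]. unfold lambda.
  generalize (fundamental_ge3 (S i) ltac:(lia)). nra.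
Qed.

(** The square of [lambda n ^ (s / 2 + 1 / 4) * mu n] is at most
    [lambda n ^ (s + 3 / 2) * Rabs (a j)] since [n ^ 2 <= lambda n], and both
    frequencies of a pair satisfy [lambda n <= 5 * p j]. *)
Lemma paired_series_in_Hinf s k a D :
  (1 <= k)%nat -> -1 <= s -> 0 <= D ->
  (forall j, Rabs (a j) <= D * Rpower (low_level k j) (- s - 3 / 2)) ->
  in_Hinf (s + 1 / 2) (paired_series k a).
Proof.
  intros hk hs hD ha. assert (hsp := levels_spectral_pairs k hk).
  set (B := Rpower 5 (s + 3 / 2) * D).
  assert (hB : 0 <= B) by (apply Rmult_le_pos; [left; apply Rpower_gt0 | exact hD]).
  (* A bound [B] on the square suffices: the absolute value of [x] is at most
     [1 + x ^ 2]. *)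
  assert (key : forall j m c, (1 <= m)%nat -> lambda (k * m) <= 5 * low_level k j ->
    c ^ 2 = Rabs (a j) ->
    Rabs (Rpower (lambda (k * m)) ((s + 1 / 2) / 2) * (INR (k * m) * c)) <= 1 + B).
  { intros j m c hm hl hc. assert (h4 := sp_ge4 _ _ _ j hsp).
    set (n := (k * m)%nat) in *.
    assert (hn : 1 <= INR n) by (apply (le_INR 1); unfold n; nia).
    assert (hnl : INR n ^ 2 <= lambda n).
    { unfold lambda. generalize PI_gt3. intros. apply pow_incr. nra. }
    set (x := Rpower (lambda n) ((s + 1 / 2) / 2) * (INR n * c)).
    assert (hx : x ^ 2 <= B).
    { replace (x ^ 2) with (Rpower (lambda n) ((s + 1 / 2) / 2) ^ 2 * (INR n ^ 2 * c ^ 2))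
        by (unfold x; ring).
      rewrite hc, <- Rmult_assoc.
      apply Rle_trans with (Rpower (5 * low_level k j) (s + 3 / 2) *
        (D * Rpower (low_level k j) (- s - 3 / 2))).
      - apply Rmult_le_compat; [| apply Rabs_pos | | apply ha].
        + apply Rmult_le_pos; apply pow2_ge_0.
        + apply Rle_trans with (Rpower (lambda n) (s + 3 / 2)).
          * rewrite <- Rpower_pow by apply Rpower_gt0. rewrite Rpower_mult.
            replace (s + 3 / 2) with ((s + 1 / 2) / 2 * INR 2 + 1) by (simpl; field).
            rewrite Rpower_plus, Rpower_1 by nra.
            apply Rmult_le_compat_l; [left; apply Rpower_gt0 | exact hnl].
          * apply Rle_Rpower_l; nra.
      - right. unfold B. rewrite <- Rpower_mult_distr by lra.
        replace (- s - 3 / 2) with (- (s + 3 / 2)) by ring.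
        rewrite Rpower_Ropp. field.
        generalize (Rpower_gt0 (low_level k j) (s + 3 / 2)). lra. }
    apply Rabs_le. nra. }
  assert (hr := fundamental_ge3 k hk).
  assert (lam : forall i, lambda (k * i) = (INR k * PI) ^ 2 * INR i ^ 2).
  { intros i. unfold lambda. rewrite mult_INR. ring. }
  apply (in_Hinf_of_bound _ _ (1 + B)). intros n hn.
  destruct (paired_series_cases k a n hk) as [z|[j [-> | ->]]].
  - rewrite z, Rmult_0_r, Rabs_R0. lra.
  - rewrite paired_series_multiple by exact hk. apply (key j); [lia | |].
    + rewrite lam, INR_3j3. unfold low_level. rewrite INR_3j3.
      rewrite <- Rmult_assoc, (Rmult_comm 5), Rmult_assoc.
      apply Rmult_le_compat_l; [nra|]. generalize (pos_INR j). nra.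
    + rewrite pair_profile_low. rewrite <- Rsqr_pow2. apply Rsqr_sqrt, Rabs_pos.
  - rewrite paired_series_multiple by exact hk. apply (key j); [lia | |].
    + rewrite lam, INR_3j4. unfold low_level. rewrite INR_3j3.
      rewrite <- Rmult_assoc, (Rmult_comm 5), Rmult_assoc.
      apply Rmult_le_compat_l; [nra|]. generalize (pos_INR j). nra.
    + rewrite pair_profile_high. apply signed_sqrt_sq.
Qed.

Lemma japanese_bounds w : 1 <= w -> w <= japanese w <= 2 * w /\ japanese w - w <= / w.
Proof.
  intros hw. unfold japanese.
  assert (h0 := sqrt_pos (1 + w ^ 2)).
  assert (h2 := sqrt_sqrt (1 + w ^ 2) ltac:(nra)).
  set (J := sqrt (1 + w ^ 2)) in *.
  assert (hJ : w <= J) by nra.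
  split; [split; nra|].
  apply Rmult_le_reg_r with w; [lra|]. rewrite Rinv_l by lra. nra.
Qed.

(** Replacing [w] by its Japanese bracket changes a power of [w] by a relative
    error [O(w ^ (- 2))], hence the restriction [nu <= 2] on the gains. *)
Lemma japanese_power_close w a :
  1 <= w -> 0 <= a ->
  Rabs (Rpower w (- a) - Rpower (japanese w) (- a)) <= a * Rpower w (- (a + 2)).
Proof.
  intros hw ha. destruct (japanese_bounds w hw) as [[h1 h2] h3].
  set (J := japanese w) in *.
  assert (hd : Rpower J (- a) <= Rpower w (- a)) by (apply Rpower_decr; lra).
  rewrite Rabs_right by lra.
  assert (h := increment_le (fun y => - Rpower y (- a))
    (fun y => a * Rpower w (- a - 1) * y)
    (fun y => - (- a * Rpower y (- a - 1))) (fun _ => a * Rpower w (- a - 1)) w J h1).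
  apply Rle_trans with (a * Rpower w (- a - 1) * (J - w)).
  - rewrite Rmult_minus_distr_l.
    replace (Rpower w (- a) - Rpower J (- a)) with
      (- Rpower J (- a) - - Rpower w (- a)) by ring.
    apply h.
    + intros y hy. apply @is_derive_opp. apply is_derive_Rpower. lra.
    + intros y hy. evar_last; [apply @is_derive_scal, @is_derive_id|].
      unfold one; simpl. ring.
    + intros y hy. rewrite <- Ropp_mult_distr_l, Ropp_involutive.
      apply Rmult_le_compat_l; [exact ha|]. apply Rpower_decr; lra.
  - replace (- (a + 2)) with (- a - 1 + - (1)) by ring.
    rewrite Rpower_plus, Rpower_Ropp, Rpower_1, <- Rmult_assoc by lra.
    apply Rmult_le_compat_l; [|lra].
    apply Rmult_le_pos; [exact ha | left; apply Rpower_gt0].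
Qed.

Lemma bigO_japanese (eps alpha nu c a : R) (f g : R -> R) :
  Rabs eps = 1 -> 0 <= a -> 0 < alpha -> 0 < nu <= 2 ->
  (forall w, f w = eps * g w) ->
  (forall w, 1 <= w ->
     Rabs (g w - alpha * Rpower w (- a)) <= c * Rpower w (- (a + nu))) ->
  bigO_pinfty (fun w => f w - eps * (alpha / Rpower (japanese w) a))
              (fun w => 1 / Rpower (japanese w) (a + nu)).
Proof.
  intros he ha hal hnu hf hg.
  exists ((c + alpha * a) * Rpower 2 (a + nu)). exists 1. intros w hw.
  rewrite hf. unfold Rdiv. rewrite <- !Rpower_Ropp, Rmult_1_l.
  rewrite <- Rmult_minus_distr_l, Rabs_mult, he, Rmult_1_l.
  rewrite (Rabs_right (Rpower _ _)) by (left; apply Rpower_gt0).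
  assert (h1 := hg w ltac:(lra)).
  assert (h2 := japanese_power_close w a ltac:(lra) ha).
  destruct (japanese_bounds w ltac:(lra)) as [[b1 b2] _].
  set (J := japanese w) in *.
  assert (hc : 0 <= c).
  { assert (0 <= c * Rpower w (- (a + nu))).
    { apply Rle_trans with (2 := h1). apply Rabs_pos. }
    generalize (Rpower_gt0 w (- (a + nu))). nra. }
  assert (h3 : Rpower w (- (a + 2)) <= Rpower w (- (a + nu))) by (apply Rle_Rpower; lra).
  assert (h4 : Rpower w (- (a + nu)) <= Rpower 2 (a + nu) * Rpower J (- (a + nu))).
  { apply Rle_trans with (Rpower (J / 2) (- (a + nu))).
    - apply Rpower_decr; lra.
    - right. replace (Rpower 2 (a + nu)) with (Rpower (/ 2) (- (a + nu))).
      + rewrite Rpower_mult_distr by lra. f_equal. field.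
      + unfold Rpower. rewrite ln_Rinv by lra. f_equal. ring. }
  replace (g w - alpha * Rpower J (- a)) with
    ((g w - alpha * Rpower w (- a)) + alpha * (Rpower w (- a) - Rpower J (- a))) by ring.
  apply Rle_trans with (1 := Rabs_triang _ _).
  rewrite Rabs_mult, (Rabs_right alpha) by lra.
  rewrite Rmult_assoc.
  apply Rle_trans with ((c + alpha * a) * Rpower w (- (a + nu))).
  - rewrite Rmult_plus_distr_r. apply Rplus_le_compat; [exact h1|].
    rewrite Rmult_assoc. apply Rmult_le_compat_l; [lra|].
    apply Rle_trans with (1 := h2). apply Rmult_le_compat_l; lra.
  - apply Rmult_le_compat_l; [|exact h4].
    apply Rplus_le_le_0_compat; [exact hc | apply Rmult_le_pos; lra].
Qed.

Theorem proposition3p8 (s : R) (hs : -1 <= s <= 1)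
    (eps : R) (heps : eps = -1 \/ eps = 1) (k : nat) (hk : (1 <= k)%nat) :
  exists mu : nat -> R,
    mu k = 0 /\
    ((-1 <= s < 0 -> in_Hinf (s + 1 / 2) mu) /\
     (s = 0 -> two_mode_combination mu) /\
     (0 < s <= 1 -> in_Hinf s mu)) /\
    (exists alpha nu : R, 0 < alpha /\ 0 < nu /\
       bigO_pinfty
         (fun w => K mu k w - eps * (alpha / Rpower (japanese w) (2 + s)))
         (fun w => 1 / Rpower (japanese w) (2 + s + nu))) /\
    (forall w : R, 0 < eps * K mu k w).
Proof.
  assert (he : Rabs eps = 1).
  { destruct heps as [-> | ->]; [rewrite Rabs_left | rewrite Rabs_right]; lra. }
  destruct (weights_exist s _ _ _ (levels_spectral_pairs k hk) hs)
    as [A [[hD [hpos [alpha [nu [c [hal [hnu hrate]]]]]]] hzero]].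
  assert (hK := fun w => K_pair_weight s eps A k w hk he (proj1 hs) hD).
  set (a := pair_weight eps A k) in *.
  assert (hreg : in_Hinf (s + 1 / 2) (paired_series k a)).
  { destruct hD as [D [hD0 hD]].
    apply (paired_series_in_Hinf s k a D hk); [lra | exact hD0 |].
    intros j. now apply pair_weight_bound. }
  exists (paired_series k a). split; [|split; [split; [|split]|split]].
  - destruct (paired_series_cases k a k hk) as [z|[j [e|e]]]; [exact z | nia | nia].
  - intros _. exact hreg.
  - intros hs0. specialize (hzero hs0).
    apply (two_mode_of_support _ (k * 3) (k * 4)); [nia | nia | nia |].
    intros i h3 h4.
    assert (ha : forall j, a (S j) = 0).
    { intros j. unfold a, pair_weight. rewrite hzero. unfold Rdiv. ring. }
    destruct (paired_series_cases k a i hk) as [z|[[|j] [e|e]]].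
    + exact z.
    + contradiction.
    + contradiction.
    + rewrite e, paired_series_multiple by exact hk.
      rewrite pair_profile_low, ha, Rabs_R0, sqrt_0. ring.
    + rewrite e, paired_series_multiple by exact hk.
      rewrite pair_profile_high, ha. unfold signed_sqrt.
      rewrite Rabs_R0, sqrt_0. ring.
  - intros h0. apply in_Hinf_le with (2 := hreg). lra.
  - exists alpha, nu. split; [exact hal | split; [apply hnu|]].
    apply (bigO_japanese eps alpha nu c (2 + s)
      _ (response (low_level k) (high_level k) A)); auto. lra.
  - intros w. rewrite hK, <- Rmult_assoc.
    replace (eps * eps) with 1 by (destruct heps as [-> | ->]; ring).
    rewrite Rmult_1_l. apply hpos.
Qed.
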